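(* Suppose $f=\sum_{i=1}^k a_i x^{d_i}\in\mathbb{F}_p[X]$ is a polynomial with $k$ terms, and an integer $d\ge 2$ satisfies $d_i\le d$ for all $i=1,\dots,k$. Then for every positive integer $r$, and every set $A\subset\mathbb{F}_p$ of size $p^{4/r}d^{40r}\le|A|\le\sqrt{p}$ we have $$|AA|+|f(A)+f(A)|\gg |A|^{1+\varepsilon},\qquad\text{where}\quad \varepsilon=\bigl(5000\,(r+k)^2\log_2 d\bigr)^{-k}.$$
   Context: Here $p$ is a prime and $\mathbb{F}_p$ is the field with $p$ elements. For sets $X,Y\subset\mathbb{F}_p$, $X+Y=\{x+y: x\in X,\ y\in Y\}$ and $XY=\{xy: x\in X,\ y\in Y\}$. For a univariate polynomial $f$, $f(A)=\{f(a): a\in A\}$. The number of elements of a finite set $S$ is denoted $|S|$. The notation $U\gg V$ means $V\le C\,U$ for some effective absolute constant $C$ (in particular, $C$ does not depend on $p$, $f$, $k$, $d$, $r$ or $A$).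
   Formalization: The polynomial f is assumed nonconstant, since for constant f the claim fails (A a long geometric progression); the absolute constant implied by ≫ is asserted to exist, without the word ''effective''. *)

(* Defs.v *)
From mathcomp Require Import all_boot all_order all_algebra.
From mathcomp Require Import reals exp.

Set Implicit Arguments.
Unset Strict Implicit.
Unset Printing Implicit Defensive.

Import Order.TTheory GRing.Theory Num.Theory.

Local Open Scope ring_scope.

Definition sumset (F : finNzRingType) (X Y : {set F}) : {set F} :=
  [set x + y | x in X, y in Y]%SET.

Definition prodset (F : finNzRingType) (X Y : {set F}) : {set F} :=
  [set x * y | x in X, y in Y]%SET.

Definition polyimage (F : finNzRingType) (f : {poly F}) (A : {set F}) :
  {set F} := [set f.[a] | a in A]%SET.

Definition log2 (R : realType) (x : R) : R := ln x / ln 2.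

(** The sparse polynomial [\sum_i a_i X^(e_i)] with exactly [k] terms: the
    coefficients are nonzero and the exponents pairwise distinct, in no
    prescribed order. *)
Definition has_terms (F : nzRingType) (k : nat) (f : {poly F})
    (a : 'I_k -> F) (e : 'I_k -> nat) : Prop :=
  [/\ forall i, a i != 0, injective e & f = \sum_(i < k) a i *: 'X^(e i)].

Definition epsilon (R : realType) (k r d : nat) : R :=
  (5000 * (r + k)%:R ^+ 2 * log2 d%:R) ^- k.

(* Main.v *)
Require Import Defs.
From mathcomp Require Import all_boot all_order all_algebra.
From mathcomp Require Import reals exp.
From mathcomp Require Import all_fingroup mpoly zify ring lra.

Set Implicit Arguments.
Unset Strict Implicit.
Unset Printing Implicit Defensive.

Import Order.TTheory GRing.Theory Num.Theory FinRing.Theory.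

Local Open Scope ring_scope.

(** Suppose that both [A A] and [f(A) + f(A)] have at most [K |A|] elements,
    where [K] is a natural number close to [|A|^epsilon].  If
    [|A|^epsilon < 2] there is nothing to do, because [|A A| >= |A|]; so
    [K >= 2], and then every numerical constant, and also [d], is at most a
    modest power of [K].  Constants can therefore be absorbed in powers of
    [K], and the contradiction comes from removing the terms of [f] one
    after the other, each removal replacing [K] by [K ^ M] with
    [M = 100 r^2 lam] and [lam] about [log2 d].  After at most [k] removals
    the loss is [K ^ (M ^ k) <= |A|], which is where the shape of [epsilon]
    comes from.

    Removing a term.  Let [a] and [b] be two exponents of [f].  Suppose that
    [\sum_j h_j ^ a = \sum_j h'_j ^ a] while
    [\sum_j h_j ^ b] and [\sum_j h'_j ^ b] differ ([j < r]).  The polynomial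
    [g(u) = \sum_j f(u h_j) - \sum_j f(u h'_j)] has lost the exponent [a] and
    kept the exponent [b].  On the set [X] of the [u] such that all [u h_j]
    and [u h'_j] are in [A], the set [g(X) + g(X)] consists of signed sums of
    [4 r] elements of [f(A)], hence is small by Plünnecke's inequality, and
    [X X] is at most as large as [A A].  When one term is left, [f(A)] is a
    multiple of a set of powers whose product set and sum set are both small,
    and this contradicts the sum-product theorem in the prime field
    ([no_structured_monomial], [sum_product_Fp]).

    Finding such [h] and [h'] ([exists_collision]).  Put
    [D_i = a^(s - i) b^i] for [i <= s], with [r = s + 1].  If no pair of
    tuples separates [a] from [b] at any of the scales
    [E_i = a^(s - 1 - i) b^i], then the sum of the powers of exponent
    [D_0 = a E_0] of a tuple determines the one of exponent
    [D_1 = b E_0 = a E_1], then the one of exponent [D_2], and so on.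
    The whole vector of these [r] power sums would take at most
    [p] values.  But power sums of [r] distinct exponents in [r] variables
    are algebraically independent, as their Jacobian is a generalized
    Vandermonde determinant, and so by the polynomial method this vector
    takes at least [B ^ r] values on a dense family of tuples
    ([card_power_sums_image]), where [B] is not much smaller than [|A|].
    Since [p ^ 4 <= |A| ^ r], this is more than [p], with enough room to
    choose two tuples for which moreover [X] is large.

    Making [X] large.  As [A A] is small, there is a large subset [Th] of
    [A] such that [x_i Th^(E_i)] is contained in [A] for every [i], for
    suitable dilation factors [x_i] ([dilate_powers]).  Each element of [Th]
    is then compatible with a positive proportion of the possible [u], the
    proportion being a power of [1 / K]; the same holds for many tuples
    ([dense_tuples]), and among sufficiently many tuples two share many [u]
    ([large_intersection]). *)

(** * Counting *)

Section Counting.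
Local Open Scope nat_scope.

Lemma sum_card_fiber (S T : finType) (A : {set S}) (B : {set T}) (phi : S -> T) :
  {in A, forall x, phi x \in B} ->
  #|A| = \sum_(y in B) #|[set x in A | phi x == y]|.
Proof.
move=> AB; rewrite -sum1_card (partition_big phi (mem B)) //=.
apply: eq_bigr => y _; rewrite -sum1_card; apply: eq_bigl => x.
by rewrite !inE.
Qed.

Lemma leq_card_fiber (S T : finType) (A : {set S}) (B : {set T}) (phi : S -> T) c :
  {in A, forall x, phi x \in B} ->
  {in B, forall y, #|[set x in A | phi x == y]| <= c} -> #|A| <= #|B| * c.
Proof.
move=> AB fib; rewrite (sum_card_fiber AB) -sum_nat_const.
exact: leq_sum.
Qed.

Lemma pigeonhole_fiber (S T : finType) (A : {set S}) (B : {set T}) (phi : S -> T) :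
  {in A, forall x, phi x \in B} -> B != set0 ->
  exists2 y, y \in B & #|A| <= #|B| * #|[set x in A | phi x == y]|.
Proof.
move=> AB /set0Pn[y0 y0B].
have [y yB ymax] := arg_maxnP (fun y => #|[set x in A | phi x == y]|) y0B.
exists y => //; apply: (leq_card_fiber AB) => y' /ymax.
exact.
Qed.

Lemma sum_nat_Cauchy (T : finType) (B : {set T}) (n : T -> nat) :
  (\sum_(y in B) n y) ^ 2 <= #|B| * \sum_(y in B) n y ^ 2.
Proof.
(* Sum [2 n x n y <= n x ^ 2 + n y ^ 2] over all pairs. *)
rewrite -(leq_pmul2l (isT : 0 < 2)).
have -> : 2 * (\sum_(y in B) n y) ^ 2
        = \sum_(x in B) \sum_(y in B) 2 * (n x * n y).
  rewrite -mulnn big_distrlr big_distrr /=.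
  by apply: eq_bigr => x _; rewrite big_distrr.
apply: (@leq_trans (\sum_(x in B) \sum_(y in B) (n x ^ 2 + n y ^ 2))).
  by apply: leq_sum => x _; apply: leq_sum => y _; rewrite nat_Cauchy.
under eq_bigr do rewrite big_split sum_nat_const /=.
by rewrite big_split sum_nat_const -big_distrr /= mul2n addnn.
Qed.

(** This is Cauchy-Schwarz for the fibres of [phi]: a map with few
    coincidences has a large image. *)
Lemma card_sq_le_energy (S T : finType) (A : {set S}) (B : {set T}) (phi : S -> T) :
  {in A, forall x, phi x \in B} ->
  #|A| ^ 2 <= #|B| * #|[set u in setX A A | phi u.1 == phi u.2]|.
Proof.
move=> AB; rewrite {1}(sum_card_fiber AB).
apply: leq_trans (sum_nat_Cauchy _ _) _; rewrite leq_mul2l; apply/orP; right.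
have AB' : {in [set u in setX A A | phi u.1 == phi u.2], forall u, phi u.1 \in B}.
  by move=> u; rewrite !inE => /andP[/andP[/AB]].
rewrite (sum_card_fiber AB'); apply: leq_sum => y yB.
rewrite -mulnn -cardsX; apply/subset_leq_card/subsetP => -[u v].
rewrite !inE /= => /andP[/andP[-> /eqP->] /andP[-> /eqP->]].
by rewrite !eqxx.
Qed.

Lemma sum_bool_card (T : finType) (B : {set T}) (P : pred T) :
  \sum_(x in B) (P x : nat) = #|[set x in B | P x]|.
Proof.
rewrite -sum1dep_card [RHS]big_mkcondr /=.
by apply: eq_bigr => x _; case: (P x).
Qed.

(** Sets of density [1 / t] in [T]: if [n z] is the number of these sets
    that contain [z], the sum of the [n z ^ 2] is at least
    [(|J| |T| / t) ^ 2 / |T|] by Cauchy-Schwarz, which the diagonal pairs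
    alone cannot provide as soon as [|J| >= 2 t ^ 2]. *)
Lemma large_intersection (I Z : finType) (J : {set I}) (A_ : I -> {set Z})
    (T : {set Z}) t :
  {in J, forall i, A_ i \subset T} ->
  {in J, forall i, #|T| <= t * #|A_ i|} ->
  T != set0 -> 2 * t ^ 2 <= #|J| -> 1 < #|J| ->
  exists i j, [/\ i \in J, j \in J, i != j & #|T| <= 2 * t ^ 2 * #|A_ i :&: A_ j|].
Proof.
move=> sAT tA; rewrite -card_gt0 => T0 tJ J1.
case: (boolP [exists i in J, [exists j in J, (i != j) &&
   (#|T| <= 2 * t ^ 2 * #|A_ i :&: A_ j|)]]) => [|no].
  case/exists_inP => i iJ /exists_inP[j jJ /andP[ij le]]; by exists i, j.
exfalso.
have small i j : i \in J -> j \in J -> i != j ->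
    2 * t ^ 2 * #|A_ i :&: A_ j| < #|T|.
  move=> iJ jJ ij; rewrite ltnNge; apply: contra no => le.
  by apply/exists_inP; exists i => //; apply/exists_inP; exists j; rewrite ?ij.
pose n z := #|[set i in J | z \in A_ i]|.
have nE z : n z = \sum_(i in J) (z \in A_ i : nat).
  by rewrite sum_bool_card.
pose Sg := \sum_(i in J) #|A_ i|.
have Sn : \sum_(z in T) n z = Sg.
  rewrite /Sg; transitivity (\sum_(z in T) \sum_(i in J) (z \in A_ i : nat)).
    by apply: eq_bigr => z _; rewrite nE.
  rewrite exchange_big /=; apply: eq_bigr => i iJ.
  rewrite sum_bool_card; apply: eq_card => z; rewrite !inE.
  by apply: andb_idl => /(subsetP (sAT i iJ)).
have Sn2 : \sum_(z in T) n z ^ 2 = \sum_(i in J) \sum_(j in J) #|A_ i :&: A_ j|.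
  transitivity (\sum_(z in T) \sum_(i in J) \sum_(j in J)
      ((z \in A_ i) && (z \in A_ j) : nat)).
    apply: eq_bigr => z _; rewrite -mulnn.
    rewrite nE.
    rewrite big_distrlr /=; apply: eq_bigr => i _; apply: eq_bigr => j _.
    by rewrite mulnb.
  rewrite exchange_big /=; apply: eq_bigr => i iJ.
  rewrite exchange_big /=; apply: eq_bigr => j jJ.
  rewrite sum_bool_card; apply: eq_card => z; rewrite !inE.
  by apply: andb_idl => /andP[/(subsetP (sAT i iJ))].
have JT : #|J| * #|T| <= t * Sg.
  rewrite -sum_nat_const big_distrr; exact: leq_sum.
have CS := sum_nat_Cauchy T n; rewrite Sn Sn2 in CS.
have t0 : 0 < t by case: (t) JT => //; nia.
have up : 2 * t ^ 2 * (\sum_(i in J) \sum_(j in J) #|A_ i :&: A_ j|)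
    < 2 * t ^ 2 * Sg + #|J| ^ 2 * #|T|.
  have -> : #|J| ^ 2 * #|T| = \sum_(i in J) \sum_(j in J) #|T|.
    by rewrite !sum_nat_const mulnA mulnn.
  rewrite !big_distrr -big_split /=.
  have [i0 i0J] : exists i, i \in J by apply/card_gt0P; lia.
  have step i : i \in J -> 2 * t ^ 2 * (\sum_(j in J) #|A_ i :&: A_ j|)
       < 2 * t ^ 2 * #|A_ i| + \sum_(j in J) #|T|.
    move=> iJ; rewrite (bigD1 i) //= setIid mulnDr ltn_add2l.
    rewrite [X in _ < X](bigD1 i) //= -add1n; apply: leq_add => //.
    rewrite big_distrr /=; apply: leq_sum => j /andP[jJ ji].
    by apply/ltnW/small; rewrite // eq_sym.
  rewrite (bigD1 i0) //= [X in _ < X](bigD1 i0) //= -addSn.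
  apply: leq_add; first exact: step.
  by apply: leq_sum => i /andP[/step/ltnW].
move: up; rewrite ltnNge => /negP; apply.
rewrite -(leq_pmul2l T0) mulnCA.
have := leq_mul (leqnn (2 * t ^ 2)) CS.
apply: leq_trans.
rewrite mulnDr.
have h1 : #|T| * (#|J| ^ 2 * #|T|) <= t ^ 2 * Sg ^ 2.
  have -> : #|T| * (#|J| ^ 2 * #|T|) = (#|J| * #|T|) * (#|J| * #|T|) by ring.
  have -> : t ^ 2 * Sg ^ 2 = (t * Sg) * (t * Sg) by ring.
  exact: leq_mul.
have h2 : 2 * t ^ 2 * #|T| <= t * Sg by apply: leq_trans JT; rewrite leq_mul2r tJ orbT.
have h3 : #|T| * (2 * t ^ 2 * Sg) <= t ^ 2 * Sg ^ 2.
  have -> : #|T| * (2 * t ^ 2 * Sg) = 2 * t ^ 2 * #|T| * Sg by ring.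
  have -> : t ^ 2 * Sg ^ 2 = t * (t * Sg * Sg) by ring.
  apply: leq_trans (leq_mul h2 (leqnn Sg)) _.
  by rewrite -[X in X <= _]mul1n leq_mul2r t0 orbT.
lia.
Qed.

(** The elements of weight less than [M / (2 t)] contribute at most half of
    the total weight. *)
Lemma popular_elements (T : finType) (X : {set T}) (w : T -> nat) M t :
  0 < M -> {in X, forall x, w x <= M} -> #|X| * M <= t * \sum_(x in X) w x ->
  #|X| <= 2 * t * #|[set x in X | M <= 2 * t * w x]|.
Proof.
move=> M0 wM Xw; set P := [set _ in _ | _].
rewrite -(leq_pmul2r M0) -(leq_add2r (#|X| * M)).
apply: (@leq_trans (\sum_(x in X) 2 * t * w x)).
  by rewrite -big_distrr /= -mulnA addnn -mul2n leq_mul2l Xw orbT.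
rewrite (bigID (mem P)) /=; apply: leq_add.
  rewrite -mulnA -[X in _ <= _ * X]sum_nat_const big_distrr /=.
  rewrite [X in _ <= X]big_mkcond [X in X <= _]big_mkcond /=.
  apply: leq_sum => x _; rewrite inE; case: (boolP (x \in X)) => //= xX.
  by case: ifP => // _; rewrite leq_mul2l wM ?orbT.
rewrite -sum_nat_const big_mkcondr /=; apply: leq_sum => x xX.
by case: (boolP (x \in P)) => //=; rewrite inE xX /= -ltnNge => /ltnW.
Qed.

End Counting.

(** * Plünnecke's inequality *)

Section Plunnecke.
Local Open Scope nat_scope.
Variable gT : finGroupType.
Hypothesis mulC : commutative (@mulg gT).
Implicit Types A B C X Y : {set gT}.
Local Notation "A ** B" := (mulg A B) (at level 40, left associativity).

Lemma set_mulC A B : A ** B = B ** A.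
Proof.
by apply/setP => z; apply/mulsgP/mulsgP => -[x y xA yB ->];
  exists y x; rewrite // mulC.
Qed.

(** Petridis' lemma, by induction on [C].  When an element [c] is added to
    [C], the translate of [X B] by [c] brings at most
    [|X B| - |Y B|] new elements, where [Y] is the set of the [x] whose
    translate [x B c] is already covered, and the minimality of the ratio
    bounds [|Y B|] from below. *)
Lemma petridis X B C :
  (forall Y, Y \subset X -> #|X ** B| * #|Y| <= #|Y ** B| * #|X|) ->
  #|X ** B ** C| * #|X| <= #|X ** B| * #|X ** C|.
Proof.
move=> Xmin; have [n] := ubnP #|C|; elim: n C => // n IHn C leCn.
have [->|[c cC]] := set_0Vmem C.
  rewrite (_ : _ ** set0 = set0) ?cards0 //.
  by apply/eqP; apply: contraT => /set0Pn[x /mulsgP[? ?]]; rewrite inE.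
pose C' := C :\ c.
have cC' : #|C'| < n by move: leCn; rewrite (cardsD1 c C) cC.
have IH := IHn _ cC'.
pose Y := [set x in X | (x *: B) :* c \subset X ** B ** C']%g.
have sYX : Y \subset X by apply/subsetP => x; rewrite inE => /andP[].
have sC'C : C' \subset C by apply: subsetDl.
have le1 : #|X ** B ** C| <= #|X ** B ** C'| + (#|X ** B| - #|Y ** B|).
  have -> : X ** B ** C = (X ** B ** C') :|: ((X ** B :\: Y ** B) :* c)%g.
    apply/setP => z; rewrite in_setU; apply/idP/idP.
      move=> /mulsgP[xb c' xbXB c'C ->].
      case: (boolP (xb * c' \in X ** B ** C')%g) => //= nin.
      have c'c : c' = c.
        apply/eqP; apply: contraT => c'c; case/negP: nin.
        by rewrite mem_mulg // !inE c'c.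
      rewrite c'c in nin *; rewrite mem_rcoset mulgK inE xbXB andbT.
      apply: contra nin => /mulsgP[y b]; rewrite inE => /andP[yX sub] bB ->.
      by apply: (subsetP sub); rewrite mem_rcoset mulgK mem_lcoset mulKg.
    case/orP => [|/rcosetP[u]].
      by apply: (subsetP (mulgS _ sC'C)).
    by rewrite inE => /andP[_ uXB] ->; apply: mem_mulg.
  apply: leq_trans (leq_card_setU _ _) _.
  rewrite leq_add2l card_rcoset cardsD leq_sub2l //.
  by apply: subset_leq_card; rewrite subsetI mulSg /=.
have le2 : #|X ** C'| + (#|X| - #|Y|) <= #|X ** C|.
  have -> : #|X| - #|Y| = #|(X :\: Y) :* c|%g.
    by rewrite card_rcoset cardsD (setIidPr sYX).
  rewrite -cardsUI (_ : _ :&: _ = set0) ?cards0 ?addn0.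
    apply: subset_leq_card; rewrite subUset mulgS //=.
    by apply/subsetP => z /rcosetP[x]; rewrite inE => /andP[_ xX] ->; apply: mem_mulg.
  apply/setP => z; rewrite !inE; apply/negP => /andP[zXC' /rcosetP[x]].
  rewrite !inE => /andP[nY xX] zE; case/negP: nY; rewrite xX /=.
  apply/subsetP => w /rcosetP[v /lcosetP[b bB ->] ->].
  rewrite -mulgA (mulC b) mulgA -zE -mulgA (set_mulC B) mulgA.
  by rewrite mem_mulg.
have YB : #|Y ** B| <= #|X ** B| by apply/subset_leq_card/mulSg.
have := Xmin _ sYX; have := subset_leq_card sYX.
move: le1 le2 YB IH.
move: #|X ** B ** C| #|X ** B ** C'| #|X ** B| #|Y ** B| #|X ** C'| #|X ** C|.
move: #|X| #|Y| => x y xbc xbc' xb yb xc' xc le1 le2 YB IH yx M.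
apply: leq_trans (leq_mul le1 (leqnn x)) _.
apply: (@leq_trans (xb * (xc' + (x - y)))); last by rewrite leq_mul2l le2 orbT.
rewrite mulnDl mulnDr leq_add // mulnBl mulnBr leq_sub2l //.
Qed.

(** The nonempty subset of [A] that minimizes [|X B| / |X|] satisfies the
    hypothesis of [petridis], with a ratio at most that of [A]. *)
Lemma exists_minimal_ratio A B K :
  A != set0 -> #|A ** B| <= K * #|A| ->
  exists X, [/\ X != set0, X \subset A &
    forall C, #|X ** B ** C| <= K * #|X ** C|].
Proof.
move=> A0 AB.
pose P X := (X != set0) && (X \subset A).
have PA : P A by rewrite /P A0 subxx.
have [X PX Xmin] : exists2 X, P X & forall Y, P Y -> #|X ** B| * #|Y| <= #|Y ** B| * #|X|.
  pose q X : rat := (#|X ** B|%:R / #|X|%:R)%R.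
  case: (arg_minP q PA) => X PX Xmin; exists X => // Y PY.
  have [cX cY] : (0 < #|X|%:R :> rat)%R /\ (0 < #|Y|%:R :> rat)%R.
    by rewrite !ltr0n !card_gt0; case/andP: PX; case/andP: PY.
  have := Xmin Y PY; rewrite /q ler_pdivrMr // mulrAC ler_pdivlMr //.
  by rewrite -!natrM ler_nat.
case/andP: (PX) => X0 sXA; exists X; split=> // C.
have cX : 0 < #|X| by rewrite card_gt0.
have cA : 0 < #|A| by rewrite card_gt0.
have XB : #|X ** B| <= K * #|X|.
  have := Xmin A; rewrite /P A0 subxx => /(_ isT) h.
  rewrite -(leq_pmul2r cA); apply: leq_trans h _.
  by rewrite mulnAC leq_mul2r AB orbT.
rewrite -(leq_pmul2r cX).
apply: leq_trans (petridis _ _) _ => [Y sYX|].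
  have [->|Y0] := eqVneq Y set0; first by rewrite cards0 muln0.
  by apply: Xmin; rewrite /P Y0 (subset_trans sYX).
by rewrite mulnAC leq_mul2r XB orbT.
Qed.

(** Fix a representation [d = b c^-1] of every quotient [d]; the pair
    [(x b, x c)] determines [d], then [x]. *)
Lemma ruzsa_triangle X B C : #|X| * #|B ** C^-1%g| <= #|X ** B| * #|X ** C|.
Proof.
have wit (d : gT) : {bc : gT * gT | d \in B ** C^-1%g ->
    [/\ bc.1 \in B, bc.2 \in C & d = bc.1 * bc.2^-1]%g}.
  case: (boolP (d \in _)) => [dBC|nd]; last by exists (d, d).
  suff /sigW[bc h] : exists bc : gT * gT,
    [&& bc.1 \in B, bc.2 \in C & d == bc.1 * bc.2^-1]%g.
    by exists bc => _; case/and3P: h => ? ? /eqP.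
  case/mulsgP: dBC => b c bB; rewrite inE => cC ->.
  by exists (b, c^-1)%g; rewrite bB cC invgK eqxx.
pose g d := sval (wit d).
have gP d : d \in B ** C^-1%g -> [/\ (g d).1 \in B, (g d).2 \in C & d = (g d).1 * (g d).2^-1]%g.
  exact: (svalP (wit d)).
rewrite -!cardsX.
pose phi (u : gT * gT) := (u.1 * (g u.2).1, u.1 * (g u.2).2)%g.
rewrite -(@card_in_imset _ _ phi).
  apply/subset_leq_card/subsetP => _ /imsetP[[x d] /setXP[xX dBC] ->].
  by have [? ? _] := gP d dBC; rewrite !inE /= !mem_mulg.
move=> [x d] [x' d'] /setXP[xX dBC] /setXP[x'X dBC'] [/= e1 e2].
have [_ _ dE] := gP d dBC; have [_ _ dE'] := gP d' dBC'.
have dd' : d = d'.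
  have : ((x * (g d).1) * (x * (g d).2)^-1 = (x' * (g d').1) * (x' * (g d').2)^-1)%g.
    by rewrite e1 e2.
  rewrite !(mulC x) !(mulC x') !invMg !mulgA !mulgK -dE -dE'; exact.
by rewrite -dd' in e1 *; move/mulIg: e1 => ->.
Qed.

(** The Plünnecke-Ruzsa inequality.  The subset [X] of minimal ratio grows
    at most by a factor [K] for each product with [B], and
    [ruzsa_triangle] passes from [X B ^ m] and [X B ^ n] to the quotient. *)
Lemma plunnecke A B K m n :
  A != set0 -> #|A ** B| <= K * #|A| ->
  #|(B ^+ m)%g ** ((B ^+ n)^-1)%g| <= K ^ (m + n) * #|A|.
Proof.
move=> A0 /(exists_minimal_ratio A0)[X [X0 sXA XB]].
have XBn k : #|X ** (B ^+ k)%g| <= K ^ k * #|X|.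
  elim: k => [|k IHk]; first by rewrite expg0 mulg1 mul1n.
  rewrite expgS mulgA (leq_trans (XB _)) // expnS -mulnA leq_mul2l IHk orbT //.
have cX : 0 < #|X| by rewrite card_gt0.
apply: (@leq_trans (K ^ (m + n) * #|X|)); last first.
  by rewrite leq_mul2l subset_leq_card ?orbT.
rewrite -(leq_pmul2l cX); apply: leq_trans (ruzsa_triangle _ _ _) _.
apply: leq_trans (leq_mul (XBn m) (XBn n)) _; rewrite expnD; nia.
Qed.

Lemma expg_mulV n A : ((A ** A^-1) ^+ n = A ^+ n ** (A ^+ n)^-1)%g.
Proof.
elim: n => [|n IHn]; first by rewrite !expg0 invg1 mulg1.
rewrite !expgS IHn invMg -!mulgA; congr (_ ** _)%g.
by rewrite [RHS]mulgA set_mulC.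
Qed.

Lemma mem_expg_prod B n (b : 'I_n -> gT) :
  (forall i, b i \in B) -> (\prod_(i < n) b i \in B ^+ n)%g.
Proof.
elim: n b => [|n IHn] b bB; first by rewrite big_ord0 expg0 set11.
by rewrite big_ord_recl expgS mem_mulg // IHn.
Qed.

End Plunnecke.

Lemma card_mulg_le (gT : finGroupType) (A B : {set gT}) : (#|(A * B)%g| <= #|A| * #|B|)%N.
Proof.
rewrite -cardsX.
have -> : (A * B)%g = [set u.1 * u.2 | u in setX A B]%g.
  apply/setP => z; apply/mulsgP/imsetP => [[x y xA yB ->]|[[x y] /setXP[xA yB] ->]].
    by exists (x, y); rewrite // inE xA.
  by exists x y.
exact: leq_imset_card.
Qed.

(** Take for [X] a maximal subset of [A] such that the translates [x Y] are
    pairwise disjoint. *)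
Lemma ruzsa_covering (gT : finGroupType) (A Y : {set gT}) :
  Y != set0 ->
  exists X : {set gT}, (#|X| * #|Y| <= #|(A * Y)%g|)%N /\ A \subset (X * (Y * Y^-1))%g.
Proof.
move=> Y0.
pose P (X : {set gT}) := (X \subset A) &&
  [forall x in X, [forall y in X, (x != y) ==> [disjoint (x *: Y)%g & (y *: Y)%g]]].
have P0 : P set0.
  by rewrite /P sub0set; apply/forall_inP => x; rewrite inE.
have [X /maxsetP[/andP[sXA /forall_inP Xd] Xmax] _] := maxset_exists P0.
exists X; split.
  have /eqP : trivIset [set (x *: Y)%g | x in X].
    apply/trivIsetP => _ _ /imsetP[x xX ->] /imsetP[y yX ->] nxy.
    have /forall_inP/(_ y yX)/implyP := Xd x xX; apply.
    by apply: contra nxy => /eqP->.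
  have inj : {in X &, injective (fun x => (x *: Y)%g)}.
    move=> x y xX yX e; apply/eqP; apply: contraT => nxy.
    have /forall_inP/(_ y yX)/implyP/(_ nxy) := Xd x xX; rewrite e -setI_eq0 setIid.
    by rewrite -cards_eq0 card_lcoset cards_eq0 (negbTE Y0).
  rewrite big_imset //= => e.
  rewrite -sum_nat_const -(eq_bigr _ (fun x _ => card_lcoset Y x)) e.
  apply/subset_leq_card/bigcupsP => _ /imsetP[x xX ->].
  by apply/subsetP => _ /lcosetP[y yY ->]; rewrite mem_mulg // (subsetP sXA).
apply/subsetP => a aA.
have [/exists_inP[x xX]|none] := boolP [exists x in X, ~~ [disjoint (x *: Y)%g & (a *: Y)%g]].
  case/pred0Pn => z /andP[/= /lcosetP[y yY ->] /lcosetP[y' y'Y e]].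
  have -> : a = (x * (y * y'^-1))%g by rewrite mulgA e mulgK.
  by rewrite !mem_mulg // inE invgK.
have dj x : x \in X -> [disjoint (x *: Y)%g & (a *: Y)%g].
  by move=> xX; apply: contraR none => h; apply/exists_inP; exists x.
have e : a |: X = X.
  apply: Xmax; last exact: subsetUr.
  rewrite /P subUset sub1set aA sXA /=.
  apply/forall_inP => x; rewrite !inE => xX; apply/forall_inP => y; rewrite !inE => yX.
  apply/implyP => nxy; case/orP: xX => [/eqP xa|xX]; case/orP: yX => [/eqP ya|yX].
  - by rewrite xa ya eqxx in nxy.
  - by rewrite xa disjoint_sym dj.
  - by rewrite ya dj.
  - by have /forall_inP/(_ y yX)/implyP := Xd x xX; apply.
have [y yY] := set0Pn _ Y0.
by rewrite -[a]mulg1 -(mulgV y) !mem_mulg // ?inE ?invgK // -e setU11.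
Qed.

(** * Sum and product sets in a finite field *)

Section FiniteField.
Variable F : finFieldType.
Implicit Types A B X Y : {set F}.

Definition quotset X Y : {set F} := [set x / y | x in X, y in Y].
Definition dilate (a : F) X : {set F} := [set a * x | x in X].

Lemma mem_sumset X Y x y : x \in X -> y \in Y -> x + y \in sumset X Y.
Proof. by move=> xX yY; apply: imset2_f. Qed.

Lemma mem_prodset X Y x y : x \in X -> y \in Y -> x * y \in prodset X Y.
Proof. by move=> xX yY; apply: imset2_f. Qed.

Lemma mem_quotset X Y x y : x \in X -> y \in Y -> x / y \in quotset X Y.
Proof. by move=> xX yY; apply: imset2_f. Qed.

Lemma sumsetE X Y : sumset X Y = (X * Y)%g.
Proof. by apply/setP => z; apply/imset2P/mulsgP => -[x y xX yY ->]; exists x y. Qed.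

Lemma card_dilate a X : a != 0 -> #|dilate a X| = #|X|.
Proof. by move=> a0; rewrite card_imset //; apply: mulfI. Qed.

Lemma plunnecke_add A K m n : A != set0 -> (#|sumset A A| <= K * #|A|)%N ->
  (#|((A ^+ m) * (A ^+ n)^-1)%g| <= K ^ (m + n) * #|A|)%N.
Proof. rewrite sumsetE; apply: plunnecke; exact: addrC. Qed.

Lemma card_signed_sums A K m (Z : {set F}) : A != set0 -> (#|sumset A A| <= K * #|A|)%N ->
  {in Z, forall z, exists b c : 'I_m -> F, [/\ forall i, b i \in A, forall i, c i \in A
    & z = \sum_i b i - \sum_i c i]} ->
  (#|Z| <= K ^ (m + m) * #|A|)%N.
Proof.
move=> A0 AA ZP; apply: leq_trans (plunnecke_add m m A0 AA).
apply/subset_leq_card/subsetP => z /ZP[b [c [bA cA ->]]].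
apply: (@mem_mulg F).
  exact: (mem_expg_prod bA).
by rewrite inE invgK (mem_expg_prod cA).
Qed.

Lemma unit_preim A : 0 \notin A -> val @: [set u : {unit F} | val u \in A] = A.
Proof.
move=> A0; apply/setP => x; apply/imsetP/idP => [[u]|xA]; first by rewrite inE => ? ->.
have Ux : x \is a GRing.unit by rewrite unitfE; apply: contraNneq A0 => <-.
by exists (FinRing.Unit Ux); rewrite ?inE.
Qed.

(** Multiplicative form of [plunnecke], in the group of units of [F]. *)
Lemma card_quotset A K : 0 \notin A -> A != set0 -> (#|prodset A A| <= K * #|A|)%N ->
  (#|quotset A A| <= K ^ 2 * #|A|)%N /\ (#|quotset (prodset A A) A| <= K ^ 3 * #|A|)%N.
Proof.
move=> nA0 A0; pose G := [set u : {unit F} | val u \in A].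
have GA : val @: G = A := unit_preim nA0.
have cG : #|G| = #|A| by rewrite -GA card_imset //; exact: val_inj.
have G0 : G != set0 by rewrite -card_gt0 cG card_gt0.
have imM (X Y : {set {unit F}}) : val @: (X * Y)%g = prodset (val @: X) (val @: Y).
  apply/setP => z; apply/imsetP/imset2P.
    case=> _ /mulsgP[x y xX yY ->] ->; exists (val x) (val y); rewrite ?imset_f //.
  case=> _ _ /imsetP[x xX ->] /imsetP[y yY ->] ->.
  by exists (x * y)%g; rewrite ?mem_mulg.
have imV (X Y : {set {unit F}}) : val @: (X * Y^-1)%g = quotset (val @: X) (val @: Y).
  apply/setP => z; apply/imsetP/imset2P.
    case=> _ /mulsgP[x y xX yY ->] ->; exists (val x) (val y^-1%g); rewrite ?imset_f //.
      by move: yY; rewrite inE.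
    by rewrite FinRing.val_unitM FinRing.val_unitV invrK.
  case=> _ _ /imsetP[x xX ->] /imsetP[y yY ->] ->.
  by exists (x * y^-1)%g; rewrite ?mem_mulg // inE invgK.
have ci (X : {set {unit F}}) : #|val @: X| = #|X| by rewrite card_imset //; exact: val_inj.
rewrite -GA -imM -!imV !ci => GG.
have mulC : commutative (@mulg {unit F}).
  by move=> x y; apply: val_inj; rewrite !FinRing.val_unitM mulrC.
have P m n := plunnecke mulC m n G0 GG.
by split; [have := P 1 1 | have := P 2 1]; rewrite ?expg1 ?expgS ?expg0 ?mulg1.
Qed.

(** The products [x y t ^ (E1 + E2)] lie in [A A], which
    is covered [|A|] times by the multiples [u A] with [u] in [A A / A].  As
    there are at most [Q |A|] such [u], one of these multiples receives a
    proportion [1 / Q] of the [t]. *)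
Lemma dilate_power_add A (Th : {set F}) Q x y E1 E2 :
  0 \notin A -> A != set0 -> (#|quotset (prodset A A) A| <= Q * #|A|)%N ->
  {in Th, forall t, x * t ^+ E1 \in A} -> {in Th, forall t, y * t ^+ E2 \in A} ->
  exists (Th' : {set F}) z, [/\ Th' \subset Th, (#|Th| <= Q * #|Th'|)%N
    & {in Th', forall t, z * t ^+ (E1 + E2) \in A}].
Proof.
move=> nA0 A0 AAA h1 h2.
pose phi (u : F * F) := x * y * u.1 ^+ (E1 + E2) / u.2.
have phiP : {in setX Th A, forall u, phi u \in quotset (prodset A A) A}.
  move=> [t w] /setXP[tT wA]; apply: mem_quotset => //.
  by rewrite exprD mulrACA mem_prodset ?h1 ?h2.
have Q0 : quotset (prodset A A) A != set0.
  have [a aA] := set0Pn _ A0.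
  by apply/set0Pn; exists (a * a / a); rewrite mem_quotset ?mem_prodset.
have [u /imset2P[v w vAA wA uE] le] := pigeonhole_fiber phiP Q0.
have nz b : b \in A -> b != 0 by move=> bA; apply: contraNneq nA0 => <-.
have u0 : u != 0.
  case/imset2P: vAA uE => b c bA cA -> ->.
  by rewrite !mulf_neq0 ?invr_eq0 ?nz.
have key t b : b \in A -> phi (t, b) = u -> u^-1 * x * y * t ^+ (E1 + E2) = b.
  move=> bA e; rewrite -!mulrA (mulrA x).
  have -> : x * y * t ^+ (E1 + E2) = u * b by rewrite -e /phi /= divfK ?nz.
  by rewrite mulKf.
exists [set t in Th | u^-1 * x * y * t ^+ (E1 + E2) \in A], (u^-1 * x * y); split.
- by apply/subsetP => t; rewrite inE => /andP[].
- have cA : (0 < #|A|)%N by rewrite card_gt0.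
  rewrite -(leq_pmul2r cA) -cardsX (leq_trans le) // mulnAC leq_mul //.
  rewrite -(@card_in_imset _ _ fst).
    apply/subset_leq_card/subsetP => _ /imsetP[[t b] + ->] /=.
    by rewrite !inE /= => /andP[/andP[-> bA] /eqP/key->].
  move=> [t b] [t' b']; rewrite !inE /= => /andP[/andP[_ bA] /eqP/key e].
  move=> /andP[/andP[_ bA'] /eqP/key e'] tt'.
  by congr (_, _) => //; rewrite -e // -e' // tt'.
- by move=> t; rewrite inE => /andP[].
Qed.

(** Each exponent below [2 ^ l] is reached by [l] doublings, each followed
    by at most one addition of [1]; the steps are instances of
    [dilate_power_add], and the exponents are treated one after the other
    inside the set obtained so far. *)
Lemma dilate_powers A (Q l : nat) (es : seq nat) (Th : {set F}) :
  0 \notin A -> A != set0 -> (#|quotset (prodset A A) A| <= Q * #|A|)%N ->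
  (0 < Q)%N -> Th \subset A -> {in es, forall e, e < 2 ^ l}%N ->
  exists Th' : {set F}, [/\ Th' \subset Th, (#|Th| <= Q ^ (2 * l * size es) * #|Th'|)%N
    & {in es, forall e, exists x, {in Th', forall t, x * t ^+ e \in A}}].
Proof.
move=> nA0 A0 AAA Q0.
have one e (Th0 : {set F}) : Th0 \subset A -> (e < 2 ^ l)%N ->
  exists (Th' : {set F}) x, [/\ Th' \subset Th0, (#|Th0| <= Q ^ (2 * l) * #|Th'|)%N
    & {in Th', forall t, x * t ^+ e \in A}].
  move=> sTA; elim: l e => [|l' IH] e le.
    have [a aA] := set0Pn _ A0.
    exists Th0, a; split; rewrite ?mul1n // => t _.
    by move: le; case: (e) => // _; rewrite expr0 mulr1.
  have le2 : (e./2 < 2 ^ l')%N by rewrite -(ltn_pmul2l (isT : 0 < 2)%N) -expnS; lia.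
  have [T1 [x [s1 c1 P1]]] := IH _ le2.
  have [T2 [z [s2 c2 P2]]] := dilate_power_add nA0 A0 AAA P1 P1.
  have s20 := subset_trans s2 s1.
  have P3 : {in T2, forall t, 1 * t ^+ 1 \in A}.
    by move=> t tT; rewrite mul1r expr1 (subsetP sTA) ?(subsetP s20).
  have c2' : (#|Th0| <= Q ^ (2 * l' + 1) * #|T2|)%N.
    apply: leq_trans c1 _; rewrite expnD -mulnA leq_mul2l expn1 c2 orbT //.
  case: (boolP (odd e)) => oe.
    have [T3 [w [s3 c3 P4]]] := dilate_power_add nA0 A0 AAA P2 P3.
    exists T3, w; split; first exact: subset_trans s3 s20.
      apply: leq_trans c2' _; rewrite (_ : 2 * l'.+1 = 2 * l' + 1 + 1)%N; last by lia.
      by rewrite [in X in (_ <= X)%N]expnD -mulnA leq_mul2l expn1 c3 orbT.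
    have e' : (e = e./2 + e./2 + 1)%N by lia.
    by rewrite e'.
  exists T2, z; split => //.
    apply: leq_trans c2' _; rewrite leq_mul2r leq_pexp2l ?orbT //; lia.
  have e' : (e = e./2 + e./2)%N by lia.
  by rewrite e'.
elim: es Th => [|e es IH] Th sTA le.
  by exists Th; split; rewrite ?muln0 ?expn0 ?mul1n.
have [T1 [x [s1 c1 P1]]] := one e Th sTA (le e (mem_head _ _)).
have [e' e'es|T2 [s2 c2 P2]] := IH T1 (subset_trans s1 sTA).
  by apply: le; rewrite inE e'es orbT.
exists T2; split; first exact: subset_trans s2 s1.
  by rewrite /= mulnS expnD (leq_trans c1) // -mulnA leq_mul2l c2 orbT.
move=> e'; rewrite inE => /orP[/eqP->|/P2//].
by exists x => t tT2; apply: P1; apply: (subsetP s2).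
Qed.

(** The number of solutions of [a x = b y] in [A] is at least
    [|A| ^ 3 / K]; fix the [b] that occurs most often, and keep the [a] for
    which [a x = b y] has many solutions. *)
Lemma popular_dilate A K : 0 \notin A -> A != set0 -> (#|prodset A A| <= K * #|A|)%N ->
  exists b (A1 : {set F}), [/\ b \in A, A1 \subset A, (#|A| <= 2 * K * #|A1|)%N &
    {in A1, forall a, #|A| <= 2 * K * #|dilate a A :&: dilate b A|}%N].
Proof.
move=> nA0 A0 AA.
have cA : (0 < #|A|)%N by rewrite card_gt0.
pose phi (u : F * F) := u.1 * u.2.
have phiP : {in setX A A, forall u, phi u \in prodset A A}.
  by move=> [x y] /setXP[xA yA]; apply: mem_prodset.
have E1 := card_sq_le_energy phiP.
set E := [set u in _ | _] in E1.
have psiP : {in E, forall u, u.2.1 \in A}.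
  by move=> [[x y] [x' y']]; rewrite !inE /= => /andP[/andP[_ /andP[->]]].
have [b bA E2] := pigeonhole_fiber psiP A0.
set Eb := [set u in _ | _] in E2.
pose A1 := [set a in A | #|A| <= 2 * K * #|dilate a A :&: dilate b A|]%N.
exists b, A1; split=> //.
- by apply/subsetP => a; rewrite inE => /andP[].
- have psi1P : {in Eb, forall u, u.1.1 \in A}.
    by move=> [[x y] [x' y']]; rewrite !inE /= => /andP[/andP[/andP[/andP[->]]]].
  have E3 : (#|Eb| <= \sum_(a in A) #|dilate a A :&: dilate b A|)%N.
    rewrite (sum_card_fiber psi1P); apply: leq_sum => a aA.
    have a0 : a != 0 by apply: contraNneq nA0 => <-.
    have b0 : b != 0 by apply: contraNneq nA0 => <-.
    rewrite -(@card_in_imset _ _ (fun u : (F * F) * (F * F) => a * u.1.2)).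
      apply/subset_leq_card/subsetP => _ /imsetP[[[x y] [x' y']] + ->] /=.
      rewrite !inE /= => /andP[/andP[/andP[/andP[/andP[_ yA] /andP[_ y'A]] /eqP e]] /eqP eb /eqP ea].
      rewrite imset_f //=; apply/imsetP; exists y' => //.
      by rewrite -ea -eb; apply: e.
    move=> [[x y] [x' y']] [[x1 y1] [x1' y1']]; rewrite !inE /=.
    move=> /andP[/andP[/andP[_ /eqP e]] /eqP eb /eqP ea].
    move=> /andP[/andP[/andP[_ /eqP e1]] /eqP eb1 /eqP ea1] /(mulfI a0) yy.
    rewrite /phi /= in e e1.
    subst x x' x1 x1' y1; congr (_, _); congr (_, _).
    by apply: (mulfI b0); rewrite -e -e1.
  move: E1; rewrite cardsX => E1.
  apply: popular_elements => // [a aA|].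
    by rewrite (leq_trans (subset_leq_card (subsetIl _ _))) // leq_imset_card.
  apply: leq_trans (leq_mul (leqnn K) E3).
  rewrite -(@leq_pmul2l (#|A| * #|A|)) ?muln_gt0 ?cA // mulnn.
  by apply: leq_trans E1 (leq_trans (leq_mul AA E2) _); apply: eq_leq; ring.
- by move=> a; rewrite inE => /andP[].
Qed.

End FiniteField.

(** * A sum-product estimate in prime fields *)

(** The field is prime: this is what excludes subfields from the sum-product
    estimate. *)
Lemma Fp_succ_closed p (R : {set 'F_p}) :
  prime p -> 0 \in R -> {in R, forall x, x + 1 \in R} -> R = setT.
Proof.
move=> pp R0 R1; apply/setP => x; rewrite inE.
have nR n : n%:R \in R by elim: n => // n IHn; rewrite -addn1 natrD R1.
by have := nR x; rewrite natr_Zp.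
Qed.

Definition line_energy (F : finFieldType) (S : {set F}) (h : F) :=
  #|[set u in setX (setX S S) (setX S S) | u.1.1 + h * u.1.2 == u.2.1 + h * u.2.2]|.

(** Apart from the diagonal, a quadruple [(x, y), (x', y')] is counted for
    at most one slope [h]. *)
Lemma sum_line_energy (F : finFieldType) (S : {set F}) :
  (\sum_(h : F) line_energy S h <= #|F| * #|S| ^ 2 + (#|S| ^ 2) ^ 2)%N.
Proof.
pose W := setX (setX S S) (setX S S).
have -> : (\sum_(h : F) line_energy S h
   = \sum_(u in W) #|[set h : F | u.1.1 + h * u.1.2 == u.2.1 + h * u.2.2]%R|)%N.
  rewrite (eq_bigr (fun h => \sum_(u in W)
     (u.1.1 + h * u.1.2 == u.2.1 + h * u.2.2 : nat)%R)%N) => [|h _]; last first.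
    by rewrite sum_bool_card.
  rewrite exchange_big /=; apply: eq_bigr => u _.
  rewrite (eq_bigl (mem [set: F])) /= => [|h]; last by rewrite !inE.
  by rewrite sum_bool_card; apply: eq_card => h; rewrite !inE.
rewrite (bigID (fun u => u.1 == u.2)) /=; apply: leq_add.
  apply: leq_trans (_ : _ <= \sum_(u in [set v in W | v.1 == v.2]) #|F|)%N _.
    rewrite [X in (_ <= X)%N](eq_bigl (fun u => (u \in W) && (u.1 == u.2))) => [|u]; last by rewrite inE.
    by apply: leq_sum => u _; apply: max_card.
  rewrite sum_nat_const mulnC leq_mul2l -mulnn -cardsX.
  rewrite -(@card_in_imset _ _ fst) => [|[x y] [x' y']]; last first.
    by rewrite !inE /= => /andP[_ /eqP->] /andP[_ /eqP->] ->.
  apply/orP; right; apply/subset_leq_card/subsetP => _ /imsetP[u + ->].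
  by rewrite !inE => /andP[/andP[]].
have -> : ((#|S| ^ 2) ^ 2 = \sum_(u in W) 1)%N by rewrite sum1_card !cardsX mulnn.
rewrite [X in (_ <= X)%N](bigID (fun u => u.1 == u.2)) /=.
apply: leq_trans (leq_addl _ _); apply: leq_sum => -[[x y] [x' y']] /= /andP[_ ne].
apply/card_le1_eqP => h h'; rewrite !inE => /eqP e /eqP e'.
have ny : y - y' != 0.
  apply: contraNneq ne => /eqP; rewrite subr_eq0 => /eqP yy; move: e.
  by rewrite yy => /addIr->.
have slope g : x + g * y = x' + g * y' -> g * (y - y') = x' - x.
  by move=> eg; rewrite -(addrK (g * y') x') -eg; ring.
by apply: (mulIf ny); rewrite !slope.
Qed.

(** Let [R] be the set of the quotients [(a - b) / (c - d)].  If some [h] in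
    [R] has [h + 1] outside [R], then [x + (h + 1) y] determines [x] and [y]
    in [S].  Otherwise [R] is the whole field, and a slope of average energy
    will do. *)
Lemma exists_pivot p (S : {set 'F_p}) :
  prime p -> (1 < #|S|)%N -> (#|S| ^ 2 <= p)%N ->
  exists a b c d, [/\ a \in S, b \in S, c \in S, d \in S & c != d /\
    (line_energy S ((a - b) / (c - d) + 1)%R <= 2 * #|S| ^ 2)%N].
Proof.
move=> pp S1 Sp.
pose R := [set (v.1.1 - v.1.2) / (v.2.1 - v.2.2) | v in
   [set v in setX (setX S S) (setX S S) | v.2.1 != v.2.2]].
have RP x : x \in R -> exists a b c d, [/\ a \in S, b \in S, c \in S, d \in S & c != d /\
     x = (a - b) / (c - d)].
  case/imsetP => -[[a b] [c d]]; rewrite !inE /=.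
  move=> /andP[/andP[/andP[aS bS] /andP[cS dS]] cd] ->.
  by exists a, b, c, d.
have memR a b c d : a \in S -> b \in S -> c \in S -> d \in S -> c != d -> (a - b) / (c - d) \in R.
  move=> aS bS cS dS cd; apply/imsetP; exists ((a, b), (c, d)) => //.
  by rewrite !inE /= aS bS cS dS.
suff [h hR le] : exists2 h, h \in R & (line_energy S (h + 1)%R <= 2 * #|S| ^ 2)%N.
  have [a [b [c [d [aS bS cS dS [cd e]]]]]] := RP h hR.
  by exists a, b, c, d; split; [| | | | split; [|rewrite -e]].
have R0 : 0 \in R.
  have /card_gt1P[c [d [cS dS cd]]] := S1.
  by rewrite -(mul0r (c - d)^-1) -(subrr c) memR.
have [/exists_inP[h hR nh]|full] := boolP [exists h in R, h + 1 \notin R].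
  exists h => //; rewrite /line_energy -(@card_in_imset _ _ fst).
    apply: (@leq_trans #|setX S S|); last by rewrite cardsX mulnn leq_pmull.
    apply/subset_leq_card/subsetP => _ /imsetP[u + ->].
    by rewrite !inE => /andP[/andP[]].
  have key x y x' y' : x \in S -> y \in S -> x' \in S -> y' \in S ->
      x + (h + 1) * y = x' + (h + 1) * y' -> x = x' /\ y = y'.
    move=> xS yS xS' yS' e; have [yy|ny] := eqVneq y' y.
      by move: e; rewrite yy => /addIr->.
    case/negP: nh; have -> : h + 1 = (x - x') / (y' - y); last exact: memR.
    have ny' : y' - y != 0 by rewrite subr_eq0.
    apply: (mulIf ny'); rewrite divfK //.
    by rewrite -(addrK ((h + 1) * y) x) e; ring.
  move=> [[x y] [x' y']] [[x1 y1] [x1' y1']]; rewrite !inE /=.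
  move=> /andP[/andP[/andP[? ?] /andP[? ?]] /eqP e].
  move=> /andP[/andP[/andP[? ?] /andP[? ?]] /eqP e1] [xx yy].
  have [ex ey] : x = x' /\ y = y' by apply: key.
  have [ex1 ey1] : x1 = x1' /\ y1 = y1' by apply: key.
  by rewrite -ex -ey -ex1 -ey1 xx yy.
have RT : R = setT.
  apply: Fp_succ_closed => // x xR.
  by apply: contraR full => nx; apply/exists_inP; exists x.
suff [h le] : exists h, (line_energy S h <= 2 * #|S| ^ 2)%N.
  by exists (h - 1); rewrite ?subrK // RT in_setT.
case: (boolP [exists h, line_energy S h <= 2 * #|S| ^ 2]%N) => [/existsP//|].
rewrite negb_exists => /forallP big.
have := sum_line_energy S.
have : (\sum_(h : 'F_p) (2 * #|S| ^ 2).+1 <= \sum_(h : 'F_p) line_energy S h)%N.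
  by apply: leq_sum => h _; rewrite ltnNge big.
rewrite sum_nat_const card_Fp // => l1 l2.
have := leq_trans l1 l2; have p0 := prime_gt0 pp.
move: (#|S| ^ 2)%N Sp => n2 Sp; have := leq_mul Sp (leqnn n2).
by rewrite mulnS (mulnCA p 2) -mulnn; move: (p * n2)%N (n2 * n2)%N => u v; lia.
Qed.

(** For the elements [a] of a popular subset [S] of [A], a few translates of
    [b A - b A] cover [a A].  For the slope [h] provided by
    [exists_pivot], multiplying [x + h y] by [a3 - a4] gives a combination of
    six products of elements of [S] by elements of [A], so that the set of
    these combinations is small by Plünnecke's inequality; but by the choice
    of [h] it has about [|S| ^ 2] elements. *)
Lemma sum_product_Fp p (A : {set 'F_p}) (K : nat) :
  prime p -> 0 \notin A -> A != set0 -> (#|A| ^ 2 <= p)%N ->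
  (#|prodset A A| <= K * #|A|)%N -> (#|sumset A A| <= K * #|A|)%N ->
  (#|A| <= 512 * K ^ 26)%N.
Proof.
move=> pp nA0 A0 Ap AA sA.
have cA : (0 < #|A|)%N by rewrite card_gt0.
have K0 : (0 < K)%N.
  have [a aA] := set0Pn _ A0; case: (K) AA => //.
  by rewrite mul0n leqn0 cards_eq0 => /eqP e; have := mem_prodset aA aA; rewrite e inE.
have [b [S [bA sSA cS SP]]] := popular_dilate nA0 A0 AA.
have b0 : b != 0 by apply: contraNneq nA0 => <-.
have [S1|S1] := leqP #|S| 1.
  apply: leq_trans cS _; apply: (@leq_trans (2 * K * 1)); first by rewrite leq_mul2l S1 orbT.
  rewrite muln1; apply: leq_mul => //; rewrite -[X in (X <= _)%N]expn1; exact: leq_pexp2l.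
have Sp : (#|S| ^ 2 <= p)%N by rewrite (leq_trans _ Ap) // leq_sqr subset_leq_card.
have [a1 [a2 [a3 [a4 [a1S a2S a3S a4S [ne le]]]]]] := exists_pivot pp S1 Sp.
set h := _ + 1 in le.
pose D := (dilate b A * (dilate b A)^-1)%g.
have cov a : a \in S -> exists X : {set 'F_p}, (#|X| <= 2 * K ^ 2)%N /\ dilate a A \subset (X * D)%g.
  move=> aS; have a0 : a != 0 by apply: contraNneq nA0 => <-; rewrite (subsetP sSA).
  pose Y := dilate a A :&: dilate b A.
  have Y0 : Y != set0.
    rewrite -card_gt0; have := SP a aS; rewrite -/Y; by case: #|Y| => //; rewrite muln0 leqNgt cA.
  have [X [cX sX]] := ruzsa_covering (dilate a A) Y0.
  exists X; split; last first.
    by apply: (subset_trans sX); rewrite mulgS // mulgSS ?invSg ?subsetIr.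
  have Y0' : (0 < #|Y|)%N by rewrite card_gt0.
  rewrite -(leq_pmul2r Y0') (leq_trans cX) //.
  apply: (@leq_trans (K * #|A|)); last first.
    by apply: leq_trans (leq_mul (leqnn K) (SP a aS)) _; rewrite -/Y; apply: eq_leq; ring.
  apply: leq_trans sA; rewrite -(card_dilate (sumset A A) a0).
  apply/subset_leq_card/subsetP => z /mulsgP[u v] /imsetP[x xA ->].
  rewrite inE => /andP[/imsetP[y yA ->] _] ->.
  by rewrite zmodMgE -mulrDr imset_f ?mem_sumset.
have [X1 [cX1 sX1]] := cov _ a1S; have [X2 [cX2 sX2]] := cov _ a2S.
have [X3 [cX3 sX3]] := cov _ a3S; have [X4 [cX4 sX4]] := cov _ a4S.
have mulC : commutative (@mulg 'F_p) by exact: addrC.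
have symD x : x \in D -> - x \in D.
  case/mulsgP => u v uD vD ->; rewrite zmodMgE opprD addrC.
  by apply: (@mem_mulg 'F_p); rewrite ?inE // in vD *; rewrite invgK.
have cD6 : (#|(D ^+ 6)%g| <= K ^ 12 * #|A|)%N.
  rewrite /D (expg_mulV mulC) -(card_dilate A b0); apply: plunnecke_add.
    by rewrite -card_gt0 card_dilate.
  rewrite card_dilate // (leq_trans _ sA) // -(card_dilate (sumset A A) b0).
  apply/subset_leq_card/subsetP => _ /imset2P[_ _ /imsetP[x xA ->] /imsetP[y yA ->] ->].
  by rewrite -mulrDr imset_f ?mem_sumset.
pose W := (X3 * X4^-1 * X1 * X2^-1 * X3 * X4^-1 * D ^+ 6)%g.
have cW : (#|W| <= (2 * K ^ 2) ^ 6 * (K ^ 12 * #|A|))%N.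
  apply: leq_trans (card_mulg_le _ _) (leq_mul _ cD6).
  rewrite (_ : forall q, q ^ 6 = q * q * q * q * q * q)%N; last by move=> q; ring.
  by do 5?[apply: leq_trans (card_mulg_le _ _) (leq_mul _ _)]; rewrite ?card_invg.
(* [phi (x, y) = a3 x - a4 x + a1 y - a2 y + a3 y - a4 y] *)
pose phi (u : 'F_p * 'F_p) := (a3 - a4) * (u.1 + h * u.2).
have phiW : {in setX S S, forall u, phi u \in W}.
  move=> [x y] /setXP[/(subsetP sSA) xA /(subsetP sSA) yA].
  have ex a X z : dilate a A \subset (X * D)%g -> z \in A ->
      exists2 c, c \in X & exists2 t, t \in D & a * z = c + t.
    move=> /subsetP sub zA; have /sub/mulsgP[c t cX tD e] : a * z \in dilate a A by exact: imset_f.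
    by exists c => //; exists t.
  have [c1 c1X [t1 t1D e1]] := ex _ _ y sX1 yA.
  have [c2 c2X [t2 t2D e2]] := ex _ _ y sX2 yA.
  have [c3 c3X [t3 t3D e3]] := ex _ _ x sX3 xA.
  have [c4 c4X [t4 t4D e4]] := ex _ _ x sX4 xA.
  have [c5 c5X [t5 t5D e5]] := ex _ _ y sX3 yA.
  have [c6 c6X [t6 t6D e6]] := ex _ _ y sX4 yA.
  have -> : phi (x, y) = (c3 - c4 + c1 - c2 + c5 - c6) + (t3 + (- t4 + (t1 + (- t2 + (t5 - t6))))).
    have a34 : a3 - a4 != 0 by rewrite subr_eq0.
    have -> : phi (x, y) = a3 * x - a4 * x + a1 * y - a2 * y + a3 * y - a4 * y.
      by rewrite /phi /h /=; field.
    by rewrite e1 e2 e3 e4 e5 e6; ring.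
  rewrite /W !expgS expg0 mulg1.
  by repeat (apply: (@mem_mulg 'F_p)); rewrite ?symD // inE /= ?invgK ?opprK.
have E := card_sq_le_energy phiW.
have a34 : a3 - a4 != 0 by rewrite subr_eq0.
rewrite cardsX mulnn in E.
have E2 : (#|S| ^ 2 <= 2 * #|W|)%N.
  have S0 : (0 < #|S| ^ 2)%N by rewrite expn_gt0 (ltnW S1).
  rewrite -(leq_pmul2r S0) mulnn (leq_trans E) //.
  rewrite -mulnA mulnCA leq_mul2l; apply/orP; right.
  apply: leq_trans le; apply: eq_leq; apply: eq_card => u.
  by rewrite !inE /phi (inj_eq (mulfI a34)).
have E3 : (#|A| ^ 2 <= (2 * K) ^ 2 * #|S| ^ 2)%N by rewrite -expnMn leq_sqr.
rewrite -(leq_pmul2r cA) mulnn (leq_trans E3) //.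
apply: leq_trans (leq_mul (leqnn _) E2) _.
apply: leq_trans (leq_mul (leqnn _) (leq_mul (leqnn 2) cW)) _.
apply: eq_leq; ring.
Qed.

(** * Zeros of polynomial functions on product sets *)

Definition power_set (S : finType) (m : nat) (A : {set S}) : {set {ffun 'I_m -> S}} :=
  [set x : {ffun 'I_m -> S} | [forall i, x i \in A]].

Lemma power_setP (S : finType) m (A : {set S}) (x : {ffun 'I_m -> S}) :
  reflect (forall i, x i \in A) (x \in power_set m A).
Proof. by rewrite inE; apply: forallP. Qed.

Lemma card_power_set (S : finType) m (A : {set S}) : #|power_set m A| = (#|A| ^ m)%N.
Proof.
rewrite -[m in RHS]card_ord -card_ffun_on; apply: eq_card => x.
by rewrite inE; apply/forallP/ffun_onP.
Qed.

Definition update_coord (S : Type) m (x : {ffun 'I_m -> S}) (j : 'I_m) (t : S) : {ffun 'I_m -> S} :=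
  [ffun i => if i == j then t else x i].

Lemma card_bigcup_le (I T : finType) (B : I -> {set T}) :
  (#|\bigcup_i B i| <= \sum_i #|B i|)%N.
Proof.
elim/big_ind2: _ => [|A n1 B' n2 h1 h2|//]; first by rewrite cards0.
exact: leq_trans (leq_card_setU _ _) (leq_add h1 h2).
Qed.

Section Slices.
Variables (F : finFieldType) (m : nat).
Implicit Types (h : {ffun 'I_m -> F} -> F) (x : {ffun 'I_m -> F}).

(** [h] is polynomial, of size at most [s], in each coordinate separately.
    This is all that the counting of zeros needs, and it holds for
    compositions and determinants without computing their degrees. *)
Definition slice_size h s := forall x j,
  exists q : {poly F}, (size q <= s)%N /\ forall t, h (update_coord x j t) = q.[t].

Lemma card_roots_le (q : {poly F}) : q != 0 -> (#|[set t | root q t]| <= size q)%N.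
Proof.
move=> q0; rewrite cardE; apply/ltnW/max_poly_roots => //; last exact: enum_uniq.
by apply/allP => t; rewrite mem_enum inE.
Qed.

(** Schwartz-Zippel by a hybrid argument: replace the coordinates of [y],
    where [h] does not vanish, by those of a zero [x], from the first to the
    last.  There is a coordinate [j] at which the value becomes [0]; the
    values of [x j] for which this happens are roots of a nonzero polynomial
    that depends only on the preceding coordinates of [x]. *)
Lemma card_zeros_slice h s (Th : {set F}) y : slice_size h s -> h y != 0 ->
  (#|[set x in power_set m Th | h x == 0%R]| * #|Th| <= m * s * #|Th| ^ m)%N.
Proof.
move=> hs hy.
pose hyb x (j : nat) : {ffun 'I_m -> F} := [ffun i : 'I_m => if (i < j)%N then x i else y i].
pose bad (j : 'I_m) := [set x in power_set m Th | (h (hyb x j) != 0) && (h (hyb x j.+1) == 0)].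
have sub : [set x in power_set m Th | h x == 0] \subset \bigcup_j bad j.
  apply/subsetP => x; rewrite inE => /andP[xT /eqP hx].
  have [k kP kmin] : exists2 k, h (hyb x k) == 0 & forall j, (j < k)%N -> h (hyb x j) != 0.
    have ex : exists k, h (hyb x k) == 0.
      exists m; have -> : hyb x m = x by apply/ffunP => i; rewrite ffunE ltn_ord.
      by rewrite hx.
    case: (ex_minnP ex) => k kP kmin; exists k => // j; apply: contraTN => /kmin.
    by rewrite -leqNgt.
  have k0 : (0 < k)%N.
    case: (k) kP => // /eqP e; case/eqP: hy; rewrite -e; congr h.
    by apply/ffunP => i; rewrite ffunE.
  have km : (k.-1 < m)%N.
    rewrite prednK // leqNgt; apply/negP => mk.
    have := kmin m mk; rewrite (_ : hyb x m = x) ?hx ?eqxx //.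
    by apply/ffunP => i; rewrite ffunE ltn_ord.
  apply/bigcupP; exists (Ordinal km) => //.
  by rewrite inE xT /= prednK // kP andbT kmin // prednK.
have badle (j : 'I_m) : (#|bad j| * #|Th| <= #|Th| ^ m * s)%N.
  rewrite -cardsX -card_power_set.
  apply: (leq_card_fiber (phi := fun u => update_coord u.1 j u.2)).
    move=> [x t] /setXP[]; rewrite inE => /andP[/power_setP xT _] tT.
    by apply/power_setP => i; rewrite ffunE; case: ifP.
  move=> w _; pose v := hyb w j.
  have [q [sq qE]] := hs v j.
  have hybw x t : update_coord x j t = w -> hyb x j = v.
    move=> e; apply/ffunP => i; rewrite !ffunE -e ffunE; case: ifP => // ij.
    by case: eqP => // ii; rewrite ii ltnn in ij.
  have hybS x : hyb x j = v -> hyb x j.+1 = update_coord v j (x j).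
    move=> e; apply/ffunP => i; rewrite [RHS]ffunE -e !ffunE ltnS; case: eqP => [->|/eqP ne].
      by rewrite leqnn.
    by rewrite leq_eqVlt (negbTE (ne : (i : nat) != j)).
  have vj : update_coord v j (y j) = v.
    by apply/ffunP => i; rewrite !ffunE; case: eqP => // ->; rewrite ltnn.
  have [hv|hv] := eqVneq (h v) 0.
    rewrite (_ : [set _ in _ | _] = set0) ?cards0 //; apply/setP => -[x t].
    rewrite !inE /=; apply/negP => /andP[/andP[/andP[_ /andP[hx _]] _] /eqP/hybw e].
    by rewrite e hv eqxx in hx.
  have q0 : q != 0.
    by apply: contraNneq hv => q0; rewrite -vj qE q0 horner0.
  apply: leq_trans (leq_trans (card_roots_le q0) sq).
  rewrite -(@card_in_imset _ _ (fun u : {ffun 'I_m -> F} * F => u.1 j)).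
    apply/subset_leq_card/subsetP => _ /imsetP[[x t] + ->].
    rewrite !inE /= => /andP[/andP[/andP[_ /andP[_ hx]] _] /eqP/hybw e].
    by rewrite /root -qE -hybS.
  move=> [x t] [x' t']; rewrite !inE /= => /andP[_ /eqP e] /andP[_ /eqP e'] xx.
  have ee i : update_coord x j t i = update_coord x' j t' i by rewrite e e'.
  congr (_, _); last by have := ee j; rewrite !ffunE eqxx.
  apply/ffunP => i; have := ee i; rewrite !ffunE.
  by case: eqP => // ->.
apply: leq_trans (leq_mul (subset_leq_card sub) (leqnn _)) _.
apply: leq_trans (leq_mul (card_bigcup_le _) (leqnn _)) _.
rewrite big_distrl /=; apply: (@leq_trans (\sum_(j < m) (#|Th| ^ m * s))%N).
  by apply: leq_sum => j _; apply: badle.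
by rewrite sum_nat_const card_ord; apply: eq_leq; ring.
Qed.

(** Two polynomial functions that are not identically zero have together too
    few zeros to fill the whole space. *)
Lemma slice_mul_eq0 h1 h2 s1 s2 : slice_size h1 s1 -> slice_size h2 s2 ->
  (m * (s1 + s2) < #|F|)%N -> (forall x, h1 x * h2 x = 0) ->
  (exists x, h2 x != 0) -> forall x, h1 x = 0.
Proof.
move=> S1 S2 lt h0 [x2 h2x] x1; apply/eqP; apply: contraT => h1x.
have := card_zeros_slice setT S1 h1x; have := card_zeros_slice setT S2 h2x.
rewrite cardsT => c2 c1.
have : (#|power_set m [set: F]| <=
   #|[set x in power_set m setT | h1 x == 0%R]| + #|[set x in power_set m setT | h2 x == 0%R]|)%N.
  apply: leq_trans (leq_card_setU _ _); apply/subset_leq_card/subsetP => x xT.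
  by move/eqP: (h0 x); rewrite mulf_eq0 in_setU ![in X in _ -> X]inE; move: xT; rewrite inE => ->.
rewrite card_power_set cardsT => c.
have : (#|F| ^ m * #|F| <= m * (s1 + s2) * #|F| ^ m)%N.
  apply: leq_trans (leq_mul c (leqnn _)) _; rewrite mulnDl mulnDr mulnDl leq_add //.
have F0 : (0 < #|F|)%N by apply/card_gt0P; exists 0.
have Fm : (0 < #|F| ^ m)%N by rewrite expn_gt0 F0.
by rewrite mulnC (leq_pmul2r Fm) leqNgt lt.
Qed.

End Slices.

(** * Vectors of power sums take many values *)

Section Vandermonde.
Variables (F : finFieldType) (m : nat).

Lemma poly_eq0_of_horner (q : {poly F}) :
  (size q <= #|F|)%N -> (forall t, q.[t] = 0) -> q = 0.
Proof.
move=> sq q0; apply/eqP; apply: contraT => nq.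
have : all (root q) (enum F) by apply/allP => t _; rewrite /root q0.
move/(max_poly_roots nq) => /(_ (enum_uniq _)).
by rewrite -cardE ltnNge sq.
Qed.

Definition gen_vandermonde (n : 'I_m -> nat) (x : {ffun 'I_m -> F}) : 'M[F]_m :=
  \matrix_(i, j) x j ^+ n i.

(** Distinct monomials of degree less than [|F|] are linearly independent
    functions on [F], so that the matrix of all their values has full rank
    and an invertible maximal minor. *)
Lemma exists_gen_vandermonde_neq0 (n : 'I_m -> nat) :
  injective n -> (forall i, n i < #|F|)%N -> exists x, \det (gen_vandermonde n x) != 0.
Proof.
move=> inj_n ltn.
pose M : 'M[F]_(m, #|F|) := \matrix_(i, z) (enum_val z) ^+ n i.
have fM : row_free M.
  apply: inj_row_free => v vM; pose q := \sum_i v 0 i *: 'X^(n i).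
  have q0 : q = 0.
    apply: poly_eq0_of_horner => [|t].
      apply: leq_trans (size_sum _ _ _) _; apply/bigmax_leqP => i _.
      by rewrite (leq_trans (size_scale_leq _ _)) // size_polyXn.
    have /matrixP/(_ 0 (enum_rank t)) := vM; rewrite !mxE => <-.
    rewrite horner_sum; apply: eq_bigr => i _.
    by rewrite hornerZ hornerXn mxE enum_rankK.
  apply/rowP => i; rewrite mxE; have := coef0 F (n i); rewrite -q0 coef_sum.
  rewrite (bigD1 i) //= coefZ coefXn eqxx mulr1 big1 ?addr0 // => j ji.
  by rewrite coefZ coefXn eq_sym (inj_eq inj_n) (negbTE ji) mulr0.
have fT : row_full M^T by rewrite /row_full mxrank_tr.
exists [ffun i => enum_val (fullrankfun fT i)].
rewrite -unitfE -unitmxE -unitmx_tr.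
rewrite (_ : _^T = rowsub (fullrankfun fT) M^T) ?fullrowsub_unit //.
by apply/matrixP => i j; rewrite !mxE ffunE.
Qed.

(** Expansion along the column of the variable coordinate. *)
Lemma slice_gen_vandermonde (n : 'I_m -> nat) s : (forall i, n i < s)%N ->
  slice_size (fun x => \det (gen_vandermonde n x)) s.
Proof.
move=> ltn x j.
exists (\sum_i cofactor (gen_vandermonde n x) i j *: 'X^(n i)); split=> [|t].
  apply: leq_trans (size_sum _ _ _) _; apply/bigmax_leqP => i _.
  by rewrite (leq_trans (size_scale_leq _ _)) // size_polyXn.
rewrite (expand_det_col _ j) horner_sum; apply: eq_bigr => i _.
rewrite hornerZ hornerXn mxE ffunE eqxx mulrC; congr (_ * _).
congr (_ * \det _); apply/matrixP => i' j'; rewrite !mxE ffunE.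
by rewrite eq_sym (negbTE (neq_lift _ _)).
Qed.

End Vandermonde.

Section PolyEval.
Variables (F : fieldType) (m : nat).
Implicit Types (P : {mpoly F[m]}) (u : 'I_m -> {poly F}).

Lemma horner_mmap u P t : (mmap polyC u P).[t] = P.@[fun i => (u i).[t]].
Proof.
rewrite /mmap mevalE horner_sum; apply: eq_bigr => n _.
rewrite hornerM hornerC; congr (_ * _).
by rewrite horner_prod; apply: eq_bigr => i _; rewrite horner_exp.
Qed.

Lemma size_mmap u P d : (forall i, size (u i) <= d.+1)%N ->
  (size (mmap polyC u P) <= ((msize P).-1 * d).+1)%N.
Proof.
move=> su; apply: leq_trans (size_sum _ _ _) _; apply/bigmax_leqP_seq => n nP _.
rewrite mul_polyC (leq_trans (size_scale_leq _ _)) //.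
have sp k (q : {poly F}) : (size q <= d.+1 -> size (q ^+ k) <= (k * d).+1)%N.
  move=> sq; apply: leq_trans (size_poly_exp_leq _ _) _; rewrite ltnS mulnC leq_mul2l.
  by apply/orP; right; rewrite -ltnS (leq_trans (leqSpred _)) //; case: (size q) sq.
have : (size (mmap1 u n) <= (mdeg n * d).+1)%N.
  rewrite /mmap1 mdegE big_distrl /=.
  apply: (big_ind2 (fun (q : {poly F}) k => size q <= k.+1)%N) => [|q1 k1 q2 k2 h1 h2|i _].
  - by rewrite size_poly1.
  - apply: leq_trans (size_polyMleq _ _) _.
    by move: h1 h2; case: (size q1) => [|a] /=; case: (size q2) => [|b]; lia.
  - exact: sp.
move/leq_trans; apply; rewrite ltnS leq_mul2r -ltnS (leq_trans (msize_mdeg_lt nP)) ?orbT //.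
exact: leqSpred.
Qed.

(** Induction that follows the ring structure, suited to identities between
    ring morphisms or derivations. *)
Lemma mpoly_ring_ind (Q : {mpoly F[m]} -> Prop) :
  (forall c, Q c%:MP) -> (forall i, Q 'X_i) ->
  (forall p q, Q p -> Q q -> Q (p + q)) -> (forall p q, Q p -> Q q -> Q (p * q)) ->
  forall p, Q p.
Proof.
move=> QC QX QD QM p; rewrite [p]mpolyE; elim/big_ind: _ => //.
  by rewrite -mpolyC0.
move=> n _; rewrite -mul_mpolyC; apply: (QM) => //; rewrite mpolyXE_id.
elim/big_ind: _ => // [|i _]; first by rewrite -mpolyC1.
by elim: (n i) => [|k IHk]; rewrite ?expr0 -?mpolyC1 // exprS; apply: QM.
Qed.

(** The chain rule. *)
Lemma deriv_mmap u P :
  (mmap polyC u P)^`() = \sum_i mmap polyC u (P^`M(i)) * (u i)^`().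
Proof.
elim/mpoly_ring_ind: P => [c|j|p q IHp IHq|p q IHp IHq].
- by rewrite mmapC derivC big1 // => i _; rewrite mderivC raddf0 mul0r.
- rewrite mmapX mmap1U (bigD1 j) //= mderivX mnm1E eqxx scale1r.
  rewrite (_ : (U_(j) - U_(j))%MM = 0%MM); last by apply/mnmP => k; rewrite mnmBE mnm0E subnn.
  rewrite mpolyX0 rmorph1 mul1r big1 ?addr0 // => i ij.
  by rewrite mderivX mnm1E eq_sym (negbTE ij) scale0r raddf0 mul0r.
- rewrite raddfD derivD IHp IHq -big_split; apply: eq_bigr => i _.
  by rewrite mderivD raddfD mulrDl.
- rewrite rmorphM derivM IHp IHq mulr_suml mulr_sumr -big_split; apply: eq_bigr => i _.
  by rewrite mderivM raddfD /= !rmorphM /=; ring.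
Qed.

End PolyEval.

Section PowerSums.
Variables (F : finFieldType) (m : nat).
Hypothesis natF_neq0 : forall n, (0 < n < #|F|)%N -> n%:R != 0 :> F.
Variables (D : 'I_m -> nat) (d : nat).
Hypotheses (inj_D : injective D) (D_gt0 : forall i, (0 < D i)%N) (D_le : forall i, (D i <= d)%N).
Implicit Types (x : {ffun 'I_m -> F}) (P : {mpoly F[m]}).

Definition power_sums x : {ffun 'I_m -> F} := [ffun i => \sum_j x j ^+ D i].

Definition power_sum_slice x (j : 'I_m) (i : 'I_m) : {poly F} :=
  (\sum_(k | k != j) x k ^+ D i)%:P + 'X^(D i).

Lemma power_sum_sliceE x j t i : power_sums (update_coord x j t) i = (power_sum_slice x j i).[t].
Proof.
rewrite ffunE hornerD hornerC hornerXn (bigD1 j) //= ffunE eqxx addrC; congr (_ + _).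
by apply: eq_bigr => k kj; rewrite ffunE (negbTE kj).
Qed.

Lemma slice_power_sums P :
  slice_size (fun x => P.@[power_sums x]) ((msize P).-1 * d).+1.
Proof.
move=> x j; exists (mmap polyC (power_sum_slice x j) P); split=> [|t].
  apply: size_mmap => i; apply: leq_trans (size_polyD _ _) _.
  by rewrite geq_max size_polyXn ltnS D_le andbT (leq_trans (size_polyC_leq1 _)).
by rewrite horner_mmap; apply: meval_eq => i; rewrite power_sum_sliceE.
Qed.

Lemma update_coord_id x j : update_coord x j (x j) = x.
Proof. by apply/ffunP => i; rewrite ffunE; case: eqP => // ->. Qed.

(** The restriction of the composition to a line parallel to an axis is a
    polynomial in one variable that vanishes everywhere and has small degree;
    hence it is zero, and so is its derivative. *)
Lemma power_sums_gradient P :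
  (((msize P).-1 * d).+1 <= #|F|)%N -> (forall x, P.@[power_sums x] = 0) ->
  forall x j, \sum_i (P^`M(i)).@[power_sums x] * (x j ^+ (D i).-1 *+ D i) = 0.
Proof.
move=> sP P0 x j.
have [q [sq qE]] := slice_power_sums P x j.
pose q' := mmap polyC (power_sum_slice x j) P.
have q'0 : q' = 0.
  apply: poly_eq0_of_horner => [|t].
    apply: leq_trans sP; apply: size_mmap => i; apply: leq_trans (size_polyD _ _) _.
    by rewrite geq_max size_polyXn ltnS D_le andbT (leq_trans (size_polyC_leq1 _)).
  rewrite horner_mmap -[RHS](P0 (update_coord x j t)).
  by apply: meval_eq => i; rewrite power_sum_sliceE.
have := deriv_mmap (power_sum_slice x j) P; rewrite -/q' q'0 deriv0.
move/(congr1 (fun r : {poly F} => r.[x j])); rewrite horner0 horner_sum => e; rewrite [RHS]e.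
apply: eq_bigr => i _; rewrite hornerM horner_mmap derivD derivC add0r derivXn.
rewrite hornerMn hornerXn; congr (_ * _); apply: meval_eq => k.
by rewrite -power_sum_sliceE update_coord_id.
Qed.

Lemma msize_mderiv i P k : (msize P <= k.+1)%N -> (msize P^`M(i) <= k)%N.
Proof.
move=> sP; rewrite msizeE; apply/bigmax_leqP_seq => n nP _.
have : (n + U_(i))%MM \in msupp P.
  move: nP; rewrite !mcoeff_msupp mcoeff_deriv; apply: contraNneq => ->.
  by rewrite mul0rn.
by move/msize_mdeg_lt/leq_trans/(_ sP); rewrite mdegD mdeg1 addn1 ltnS.
Qed.

(** Let [P] vanish on all vectors of power sums.  By [power_sums_gradient]
    the gradient of [P] at such a vector is killed by the Jacobian
    matrix, which is a generalized Vandermonde matrix up to the factors [D i].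
    So the partial derivatives of [P] vanish wherever its determinant does
    not, hence everywhere by [slice_mul_eq0].  By induction on
    the size they are zero polynomials, and in the absence of small
    characteristic [P] is constant. *)
Lemma power_sums_independent P :
  (m * (((msize P).-1 * d).+1 + d) < #|F|)%N -> (0 < m)%N ->
  (forall x, P.@[power_sums x] = 0) -> P = 0.
Proof.
move=> bnd m0.
have d0 : (0 < d)%N := leq_trans (D_gt0 (Ordinal m0)) (D_le _).
have := leqnn (msize P); move: {-2}(msize P) bnd.
move=> k; elim: k P => [|k IHk] P bnd sP P0.
  by apply/eqP; rewrite -msize_poly_eq0 -leqn0.
have dP i : P^`M(i) = 0.
  apply: IHk; last 1 first.
  - apply: (slice_mul_eq0 (slice_power_sums _)
      (slice_gen_vandermonde (n := fun i => (D i).-1) (s := d) _)).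
    + by move=> i'; rewrite prednK.
    + apply: leq_ltn_trans bnd; rewrite leq_mul2l leq_add2r ltnS leq_mul2r.
      have := msize_mderiv i sP; case: (msize _) => [|s] /=; lia.
    + move=> x; set V := gen_vandermonde _ x.
      have [->|dV] := eqVneq (\det V) 0; first by rewrite mulr0.
      pose g : 'rV[F]_m := \row_i ((P^`M(i)).@[power_sums x] * (D i)%:R).
      have gV : g *m V = 0.
        apply/rowP => j; rewrite !mxE.
        rewrite -[RHS](power_sums_gradient _ P0 x j); last first.
          apply: leq_trans (ltnW bnd).
          have h : ((msize P).-1 * d <= k * d)%N by rewrite leq_mul2r; case: (msize P) sP => /= *; lia.
          by rewrite /=; nia.
        by apply: eq_bigr => i' _; rewrite !mxE -mulrA mulr_natl.
      have : g = 0 by rewrite -[g](mulmxK (_ : V \in unitmx)) ?gV ?mul0mx // unitmxE unitfE.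
      move/rowP/(_ i); rewrite !mxE => /eqP; rewrite mulf_eq0 => /orP[/eqP->|]; first by rewrite mul0r.
      rewrite (negbTE (natF_neq0 _)) // D_gt0 (leq_ltn_trans (D_le i)) //.
      by apply: leq_ltn_trans bnd; nia.
    + apply: exists_gen_vandermonde_neq0 => [i1 i2|i1].
        move=> e; apply: inj_D; rewrite -(prednK (D_gt0 i1)) -(prednK (D_gt0 i2)).
        by rewrite e.
      apply: leq_ltn_trans bnd; have := D_le i1; have := D_gt0 i1; nia.
  - apply: leq_ltn_trans bnd; rewrite leq_mul2l leq_add2r ltnS leq_mul2r /=.
    by case: (k) => [|k'] /=; rewrite ?leqnSn ?orbT.
  - exact: msize_mderiv.
have cP n : n != 0%MM -> P@_n = 0.
  move=> n0; have [i ni] : exists i, (0 < n i)%N.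
    apply/existsP; apply: contraNT n0; rewrite negb_exists => /forallP h.
    by apply/eqP/mnmP => i; rewrite mnm0E; have := h i; rewrite lt0n negbK => /eqP.
  have [nP|] := boolP (n \in msupp P); last by rewrite mcoeff_msupp negbK => /eqP.
  have : (P^`M(i))@_(n - U_(i)) = 0 by rewrite dP mcoeff0.
  rewrite mcoeff_deriv submK; last first.
    by apply/mnm_lepP => j; rewrite mnm1E; case: eqP => // <-.
  rewrite mnmBE mnm1E eqxx subn1 prednK // -mulr_natr => /eqP.
  rewrite mulf_eq0 => /orP[/eqP//|]; rewrite (negbTE (natF_neq0 _)) // ni /=.
  have : (n i <= mdeg n)%N by rewrite mdegE (bigD1 i) //= leq_addr.
  have := leq_trans (msize_mdeg_lt nP) sP; move: bnd => /=; nia.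
have PC : P = (P@_0)%:MP.
  apply/mpolyP => n; rewrite mcoeffC.
  by have [->|n0] := eqVneq n 0%MM; rewrite ?mulr1 // cP // mulr0.
by have := P0 [ffun => 0]; rewrite PC mevalC => ->; rewrite mpolyC0.
Qed.

(** There are more monomials, of degree less than [B] in each variable,
    than points of [W]. *)
Lemma exists_vanishing_poly (W : {set {ffun 'I_m -> F}}) B :
  (#|W| < B ^ m)%N ->
  exists P, [/\ P != 0, (msize P <= (m * B.-1).+1)%N & forall w, w \in W -> P.@[w] = 0].
Proof.
move=> ltW; pose N := #|{ffun 'I_m -> 'I_B}|.
have cN : N = (B ^ m)%N by rewrite /N card_ffun !card_ord.
pose mon (k : 'I_N) : 'X_{1..m} := [multinom (enum_val k i : nat) | i < m].
have inj_mon : injective mon.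
  move=> k l e; apply: enum_val_inj; apply/ffunP => i; apply: val_inj => /=.
  by have := congr1 (fun n : 'X_{1..m} => n i) e; rewrite !mnmE.
pose M : 'M[F]_(N, #|W|) := \matrix_(k, z) ('X_[mon k]).@[(enum_val z : {ffun 'I_m -> F})].
have : kermx M != 0.
  rewrite kermx_eq0 /row_free; apply: contraTneq (rank_leq_col M) => ->.
  by rewrite -ltnNge cN.
case/rowV0Pn => v /sub_kermxP vM v0.
pose P := \sum_k v 0 k *: 'X_[mon k].
have Pm k : P@_(mon k) = v 0 k.
  rewrite /P raddf_sum (bigD1 k) //= mcoeffZ mcoeffX eqxx mulr1 big1 ?addr0 // => l lk.
  by rewrite mcoeffZ mcoeffX (inj_eq inj_mon) (negbTE lk) mulr0.
exists P; split.
- apply: contraNneq v0 => P0; apply/eqP/rowP => k.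
  by rewrite -Pm P0 mcoeff0 mxE.
- rewrite msizeE; apply/bigmax_leqP_seq => n nP _; rewrite ltnS.
  have [k /eqP ->] : exists k, n == mon k.
    apply/existsP; apply: contraLR nP; rewrite negb_exists => /forallP h.
    rewrite mcoeff_msupp negbK /P raddf_sum big1 //= => k _.
    by rewrite mcoeffZ mcoeffX eq_sym (negbTE (h k)) mulr0.
  rewrite mdegE -[m in X in (_ <= X)%N]card_ord -sum_nat_const; apply: leq_sum => i _.
  by rewrite mnmE; have := ltn_ord (enum_val k i); case: (B) (enum_val k i) => // ? ?.
- move=> w wW; have /matrixP/(_ 0 (enum_rank_in wW w)) := vM; rewrite !mxE => <-.
  rewrite /P raddf_sum /=; apply: eq_bigr => k _.
  by rewrite mevalZ mxE enum_rankK_in.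
Qed.

(** The polynomial method.  If [S] had fewer than [B ^ m] vectors of power
    sums, a nonzero polynomial [P] of small degree would vanish on them.
    Composed with the power sums it has more zeros than
    [card_zeros_slice] allows, hence is zero, which contradicts
    [power_sums_independent]. *)
Lemma card_power_sums_image (Th : {set F}) (S : {set {ffun 'I_m -> F}}) B t :
  let e := (m * B.-1 * d).+1 in
  S \subset power_set m Th -> (0 < m)%N -> (m * (e + d) < #|F|)%N ->
  (#|Th| ^ m <= t * #|S|)%N -> (m * e * t < #|Th|)%N ->
  (B ^ m <= #|power_sums @: S|)%N.
Proof.
move=> e sS m0 bF St et; rewrite leqNgt; apply/negP => /exists_vanishing_poly.
case=> P [P0 sP PW]; case/eqP: P0.
have se : (((msize P).-1 * d).+1 <= e)%N.
  by rewrite /e ltnS leq_mul2r; apply/orP; right; case: (msize P) sP.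
apply: power_sums_independent => // [|x]; first by apply: leq_ltn_trans bF; nia.
apply/eqP; apply: contraT => hx.
have := card_zeros_slice Th (slice_power_sums P) hx.
set Z := [set _ in _ | _]; have sSZ : S \subset Z.
  apply/subsetP => y yS; rewrite inE (subsetP sS) //=; apply/eqP/PW.
  exact: imset_f.
move=> cZ; have S0 : (0 < #|S|)%N.
  have Th0 : (0 < #|Th| ^ m)%N by rewrite expn_gt0; lia.
  by move: St Th0; case: #|S| => //; rewrite muln0; lia.
have : (#|S| * #|Th| <= #|S| * (m * e * t))%N.
  apply: leq_trans (leq_mul (subset_leq_card sSZ) (leqnn _)) _.
  apply: leq_trans cZ _; apply: leq_trans (leq_mul (leq_mul (leqnn m) se) St) _.
  by apply: eq_leq; ring.
by rewrite (leq_pmul2l S0) leqNgt et.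
Qed.

End PowerSums.

(** * Collisions of power sums *)

Section Tuples.
Local Open Scope nat_scope.

(** Double counting of the pairs of an element [z] and an element [x] of
    [Th] compatible with it: a positive proportion of the [z] are compatible
    with a proportion [1 / (2 t)] of [Th], hence with the corresponding
    power of this proportion of the tuples. *)
Lemma dense_tuples (Z W : finType) (T : {set Z}) (Th : {set W}) (N : W -> {set Z}) t m :
  T != set0 -> Th != set0 ->
  {in Th, forall x, N x \subset T} -> {in Th, forall x, #|T| <= t * #|N x|} ->
  let tau := 2 * (2 * t) ^ m.+1 in
  let common (x : {ffun 'I_m -> W}) := [set z in T | [forall j, z \in N (x j)]] in
  exists S : {set {ffun 'I_m -> W}}, [/\ S \subset power_set m Th, #|Th| ^ m <= tau * #|S|
    & {in S, forall x, #|T| <= tau * #|common x|}].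
Proof.
move=> T0 Th0 NT TN tau common.
have cT : 0 < #|T| by rewrite card_gt0.
have cTh : 0 < #|Th| by rewrite card_gt0.
pose R z := [set x in Th | z \in N x].
have RT : \sum_(z in T) #|R z| = \sum_(x in Th) #|N x|.
  rewrite (eq_bigr (fun z => \sum_(x in Th) (z \in N x : nat))) => [|z _]; last by rewrite sum_bool_card.
  rewrite exchange_big /=; apply: eq_bigr => x xTh.
  rewrite sum_bool_card; apply: eq_card => z; rewrite !inE.
  by apply: andb_idl => /(subsetP (NT x xTh)).
have pop : #|T| <= 2 * t * #|[set z in T | #|Th| <= 2 * t * #|R z|]|.
  apply: popular_elements => // [z _|].
    by apply/subset_leq_card/subsetP => x; rewrite inE => /andP[].
  by rewrite RT mulnC -sum_nat_const big_distrr; apply: leq_sum.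
set T1 := [set _ in _ | _] in pop.
have sT1 : T1 \subset T by apply/subsetP => z; rewrite inE => /andP[].
have RTm : \sum_(x in power_set m Th) #|common x| = \sum_(z in T) #|R z| ^ m.
  rewrite (eq_bigr (fun x : {ffun 'I_m -> W} => \sum_(z in T) ([forall j, z \in N (x j)] : nat))) => [|x _]; last first.
    by rewrite sum_bool_card.
  rewrite exchange_big /=; apply: eq_bigr => z zT.
  rewrite -card_power_set sum_bool_card; apply: eq_card => x; rewrite !inE.
  apply/andP/forallP => [[/forallP xTh /forallP zN] j|xR].
    by rewrite inE xTh zN.
  by split; apply/forallP => j; have := xR j; rewrite inE => /andP[].
exists [set x in power_set m Th | #|T| <= tau * #|common x|]; split.
- by apply/subsetP => x; rewrite inE => /andP[].
- rewrite -card_power_set /tau; apply: popular_elements => // [x _|].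
    by apply/subset_leq_card/subsetP => z; rewrite inE => /andP[].
  rewrite RTm card_power_set.
  apply: (@leq_trans ((2 * t) ^ m.+1 * \sum_(z in T1) #|R z| ^ m)); last first.
    rewrite leq_mul2l; apply/orP; right.
    by rewrite [X in _ <= X](big_setID T1) /= (setIidPr sT1) leq_addr.
  rewrite expnSr -mulnA mulnCA big_distrr /=.
  apply: (@leq_trans (2 * t * \sum_(z in T1) #|Th| ^ m)); last first.
    rewrite leq_mul2l; apply/orP; right; apply: leq_sum => z; rewrite inE => /andP[_ h].
    by rewrite -expnMn; case: (m) => // m'; rewrite leq_exp2r.
  by rewrite sum_nat_const mulnC mulnA leq_mul2r pop orbT.
- by move=> x; rewrite inE => /andP[].
Qed.

End Tuples.

Section Collision.
Variable F : finFieldType.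
Hypothesis natF_neq0 : forall n, (0 < n < #|F|)%N -> n%:R != 0 :> F.
Variables (A : {set F}) (K a b s d l B : nat).
Hypotheses (nA0 : 0 \notin A) (A0 : A != set0) (AA : (#|prodset A A| <= K * #|A|)%N).
Hypotheses (a0 : (0 < a)%N) (b0 : (0 < b)%N) (ab : a != b).
Hypotheses (Kgt0 : (0 < K)%N) (s_gt0 : (0 < s)%N).

(** The chain of exponents: [Dexp i = a * Eexp i] and [Dexp i.+1 = b * Eexp i],
    so that a relation of exponent [Dexp i] which fails for [Dexp i.+1]
    separates [a] from [b] on the powers of exponent [Eexp i]. *)
Let Dexp (i : nat) := (a ^ (s - i) * b ^ i)%N.
Let Eexp (i : nat) := (a ^ (s.-1 - i) * b ^ i)%N.
Let tau := (2 * (2 * K ^ (2 * s)) ^ s.+2)%N.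

Hypotheses (DexpP : forall i, (i <= s)%N -> (Dexp i <= d)%N)
  (EexpP : forall i, (i < s)%N -> (Eexp i < 2 ^ l)%N).

(** For [i < j], the equality reduces to [a ^ (j - i) = b ^ (j - i)]. *)
Lemma inj_Dexp i j : (i <= s)%N -> (j <= s)%N -> Dexp i = Dexp j -> i = j.
Proof.
wlog ij : i j / (i <= j)%N.
  by move=> W is_ js e; case/orP: (leq_total i j) => h; [|symmetry]; apply: W.
move=> is_ js e; apply/eqP; rewrite eqn_leq ij /= leqNgt; apply/negP => lt.
move: e; rewrite /Dexp (_ : s - i = (s - j) + (j - i))%N; last by lia.
have -> : (b ^ j = b ^ (j - i) * b ^ i)%N by rewrite -expnD subnK.
rewrite expnD -mulnA => /eqP.
rewrite eqn_pmul2l ?expn_gt0 ?a0 // eqn_pmul2r ?expn_gt0 ?b0 // => /eqP e.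
by move: ab; rewrite -(eqn_exp2r _ _ (_ : 0 < j - i)%N) ?subn_gt0 // e eqxx.
Qed.

(** The dilation factors are searched in the product of [s] copies of
    [A / A]: a point [z] collects one factor [z i] for each scale [i], so
    that all scales are handled by a single choice of tuples: the scale at
    which two tuples separate is known only once they are chosen.
    For some value of the power sum of exponent [Dexp 0], the tuples
    with this value still have at least [2 tau ^ 2] vectors of power sums;
    choose one tuple for each vector and apply [large_intersection]. *)
Lemma exists_collision :
  let e := (s.+1 * B.-1 * d).+1 in
  (s.+1 * (e + d) < #|F|)%N ->
  (s.+1 * e * tau * (K ^ 3) ^ (2 * l * s) < #|A|)%N ->
  (#|F| * (2 * tau ^ 2) <= B ^ s.+1)%N ->
  exists (X : {set F}) (h h' : 'I_s.+1 -> F),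
    [/\ (#|A| <= 2 * tau ^ 2 * #|X|)%N,
        {in X, forall u j, u * h j \in A}, {in X, forall u j, u * h' j \in A},
        \sum_j h j ^+ a = \sum_j h' j ^+ a & \sum_j h j ^+ b != \sum_j h' j ^+ b].
Proof.
move=> e bF bA bB.
have [cV cVA] := card_quotset nA0 A0 AA.
set V := quotset A A in cV.
have Q0 : (0 < K ^ 3)%N by rewrite expn_gt0 Kgt0.
have cA : (0 < #|A|)%N by rewrite card_gt0.
have nzA y : y \in A -> y != 0 by move=> yA; apply: contraNneq nA0 => <-.
have esP : {in [seq Eexp i | i <- iota 0 s], forall n, n < 2 ^ l}%N.
  by move=> _ /mapP[i + ->]; rewrite mem_iota add0n => /andP[_] /EexpP.
have [Th [sThA cTh Thx]] := dilate_powers nA0 A0 cVA Q0 (subxx A) esP.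
rewrite size_map size_iota in cTh.
have tau0 : (0 < tau)%N by rewrite /tau muln_gt0 expn_gt0 muln_gt0 expn_gt0 Kgt0.
have Thbig : (s.+1 * e * tau < #|Th|)%N.
  have Ql : (0 < (K ^ 3) ^ (2 * l * s))%N by rewrite expn_gt0 Q0.
  by rewrite -(ltn_pmul2r Ql) (leq_trans bA) // mulnC.
have Th0 : Th != set0 by rewrite -card_gt0 (leq_ltn_trans _ Thbig).
have /fin_all_exists[x xP] (i : 'I_s) : exists x, {in Th, forall t, x * t ^+ Eexp i \in A}.
  by apply: Thx; apply: map_f; rewrite mem_iota add0n ltn_ord.
pose hh (i : 'I_s) t := x i * t ^+ Eexp i.
pose T := power_set s V.
pose N (t : F) := [set z in T | [forall i : 'I_s, z i * hh i t \in A]].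
have V0 : V != set0.
  by have [y yA] := set0Pn _ A0; apply/set0Pn; exists (y / y); apply: mem_quotset.
have T0 : T != set0 by rewrite -card_gt0 card_power_set expn_gt0 card_gt0 V0.
have NT : {in Th, forall t, N t \subset T}.
  by move=> t _; apply/subsetP => z; rewrite inE => /andP[].
have TN : {in Th, forall t, #|T| <= K ^ (2 * s) * #|N t|}%N.
  move=> t tTh; rewrite card_power_set.
  apply: (@leq_trans (K ^ (2 * s) * #|A| ^ s)); first by rewrite expnM -expnMn leq_exp2r.
  rewrite leq_mul2l -card_power_set; apply/orP; right.
  pose g (y : {ffun 'I_s -> F}) := [ffun i => y i / hh i t].
  have hn i : hh i t != 0 by apply: nzA; apply: xP.
  rewrite -(@card_in_imset _ _ g) => [|y y' _ _ /ffunP eg]; last first.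
    apply/ffunP => i; have := eg i; rewrite !ffunE; apply: mulIf.
    by rewrite invr_eq0.
  apply/subset_leq_card/subsetP => _ /imsetP[y /power_setP yA ->].
  rewrite inE; apply/andP; split.
    by apply/power_setP => i; rewrite ffunE mem_quotset ?xP.
  by apply/forallP => i; rewrite ffunE divfK.
have [S [sS cS SP]] := dense_tuples s.+1 T0 Th0 NT TN.
rewrite -/tau in cS SP.
pose common (y : {ffun 'I_s.+1 -> F}) := [set z in T | [forall j, z \in N (y j)]].
pose D (i : 'I_s.+1) := Dexp i.
have injD : injective D.
  by move=> i j /inj_Dexp e'; apply/val_inj/e'; rewrite -ltnS ltn_ord.
have D0 i : (0 < D i)%N by rewrite muln_gt0 !expn_gt0 a0 b0.
have Dd i : (D i <= d)%N by apply: DexpP; rewrite -ltnS.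
have im := card_power_sums_image natF_neq0 injD D0 Dd sS (ltn0Sn s) bF cS Thbig.
set ps := @power_sums _ _ D in im; set W := _ @: S in im.
have FT : [set: F] != set0 by apply/set0Pn; exists 0; rewrite inE.
have [v _] := @pigeonhole_fiber _ _ W setT (fun w => w ord0) (fun _ _ => in_setT _) FT.
rewrite cardsT; set J := [set _ in _ | _] => cJ.
have F0 : (0 < #|F|)%N by apply/card_gt0P; exists 0.
have J2 : (2 * tau ^ 2 <= #|J|)%N.
  by rewrite -(leq_pmul2l F0) (leq_trans bB) // (leq_trans im).
have J1 : (1 < #|J|)%N by apply: leq_trans J2; rewrite leq_pmulr // expn_gt0 tau0.
have repP w : exists y, w \in W -> y \in S /\ ps y = w.
  by case: (boolP (w \in W)) => [/imsetP[y yS ->]|_]; [exists y | exists [ffun => 0]].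
have /fin_all_exists[rep repE] := repP.
have JW w : w \in J -> w \in W by rewrite inE => /andP[].
have [||w [w' [wJ w'J ww']]] := @large_intersection _ _ J (fun w => common (rep w)) T tau _ _ T0 J2 J1.
- by move=> w _; apply/subsetP => z; rewrite inE => /andP[].
- by move=> w /JW/repE[repS _]; apply: SP.
move=> big.
have [repS repw] := repE w (JW w wJ); have [repS' repw'] := repE w' (JW w' w'J).
(* The two vectors have the same first entry: take the first place where they
   differ. *)
have [k wk wk1] : exists2 k : 'I_s, w (widen_ord (leqnSn s) k) = w' (widen_ord (leqnSn s) k)
    & w (lift ord0 k) != w' (lift ord0 k).
  have w0 : w ord0 = w' ord0.
    by move: wJ w'J; rewrite !inE => /andP[_ /eqP->] /andP[_ /eqP->].
  have ex : exists n, (n <= s)%N && (w (inord n) != w' (inord n)).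
    have /existsP[i wi] : [exists i, w i != w' i].
      rewrite -negb_forall; apply: contraNN ww' => /forallP h.
      by apply/eqP/ffunP => i; apply/eqP.
    by exists i; rewrite inord_val wi -ltnS ltn_ord.
  case: (ex_minnP ex) => -[|n] /andP[ns wn] nmin.
    by move: wn; rewrite (_ : inord 0 = ord0) ?w0 ?eqxx //; apply: val_inj; rewrite /= inordK.
  exists (Ordinal ns).
    apply/eqP; apply: contraT => wn'.
    have := nmin n; rewrite (ltnW ns) (_ : inord n = widen_ord (leqnSn s) (Ordinal ns)) ?wn' //=.
      by move/(_ isT); rewrite ltnn.
    by apply: val_inj; rewrite /= inordK // ltnS ltnW.
  rewrite (_ : lift _ _ = inord n.+1) //.
  by apply: val_inj; rewrite /= inordK.
pose X := [set u in V | [forall j, (u * hh k (rep w j) \in A) && (u * hh k (rep w' j) \in A)]].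
exists X, (fun j => hh k (rep w j)), (fun j => hh k (rep w' j)).
have repTh y j : y \in S -> y j \in Th by move=> /(subsetP sS)/power_setP.
have xk : x k != 0.
  apply: contraTneq (xP k _ (repTh _ ord0 repS)) => ->.
  by rewrite mul0r.
have sumE y c n : (Eexp k * c)%N = n -> \sum_j hh k (y j) ^+ c = x k ^+ c * \sum_(j < s.+1) y j ^+ n.
  move=> <-; rewrite mulr_sumr; apply: eq_bigr => j _.
  by rewrite /hh exprMn -exprM.
have Ea : (Eexp k * a)%N = D (widen_ord (leqnSn s) k).
  rewrite /D /Eexp /Dexp /= mulnAC -expnSr; congr (a ^ _ * _)%N.
  by rewrite -predn_sub -subnS subnSK.
have Eb : (Eexp k * b)%N = D (lift ord0 k).
  rewrite /D /Eexp /Dexp /= -mulnA -expnSr; congr (a ^ _ * b ^ _)%N.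
  by rewrite /bump leq0n add1n subnS predn_sub.
have psE y i : ps y i = \sum_j y j ^+ D i by rewrite ffunE.
split.
- have AV : (#|A| <= #|V|)%N.
    have [y yA] := set0Pn _ A0.
    rewrite -(@card_in_imset _ _ (fun z => z / y)) => [|z z' _ _]; last first.
      by apply: mulIf; rewrite invr_eq0 nzA.
    by apply/subset_leq_card/subsetP => _ /imsetP[z zA ->]; apply: mem_quotset.
  apply: leq_trans AV _.
  have cT : (0 < #|T|)%N by rewrite card_gt0.
  rewrite -(leq_pmul2l cT); apply: leq_trans (leq_mul big (leqnn _)) _.
  rewrite mulnCA -mulnA leq_mul2l; apply/orP; right.
  rewrite [X in (_ <= X)%N]mulnC -!cardsX.
  (* Exchanging the coordinate [k] of a common point with an arbitrary element
     of [V] compares the density of common points in [T] with that of [X] in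
     [V]. *)
  pose g (u : {ffun 'I_s -> F} * F) := (u.1 k, update_coord u.1 k u.2).
  rewrite -(@card_in_imset _ _ g) => [|[z c] [z' c'] _ _ [zz /ffunP ez]]; last first.
    congr (_, _); last by have := ez k; rewrite !ffunE eqxx.
    by apply/ffunP => i; have := ez i; rewrite !ffunE; case: eqP => // ->.
  apply/subset_leq_card/subsetP => _ /imsetP[[z c] + ->].
  rewrite in_setX in_setI => /andP[/andP[]].
  rewrite !inE => /andP[/forallP zV /forallP zN] /andP[_ /forallP zN'] /= cV'.
  apply/andP; split; last by apply/forallP => i; rewrite ffunE; case: ifP.
  rewrite zV; apply/forallP => j.
  have := zN j; have := zN' j; rewrite !inE => /andP[_ /forallP/(_ k)->].
  by case/andP=> _ /forallP/(_ k)->.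
- by move=> u; rewrite inE => /andP[_ /forallP h] j; case/andP: (h j).
- by move=> u; rewrite inE => /andP[_ /forallP h] j; case/andP: (h j).
- by rewrite !(sumE _ _ _ Ea) -!psE repw repw' wk.
- rewrite !(sumE _ _ _ Eb) -!psE repw repw'.
  by rewrite (inj_eq (mulfI _)) ?expf_neq0.
Qed.

End Collision.

(** * Numerical parameters *)

Section Numerics.
Local Open Scope nat_scope.
Variable K : nat.
Hypothesis K2 : 2 <= K.

Lemma leq_expK m n : m <= n -> K ^ m <= K ^ n.
Proof. by move=> mn; rewrite leq_pexp2l // ltnW. Qed.

Lemma leq_2K n : 2 ^ n <= K ^ n.
Proof. by case: n => // n; rewrite leq_exp2r. Qed.

Lemma leq_natK n : n <= K ^ n.
Proof. by apply: leq_trans (ltnW (ltn_expl n (isT : 1 < 2))) (leq_2K n). Qed.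

Variable s : nat.
Let r := s.+1.
Let tau := 2 * (2 * (K ^ 2) ^ (2 * s)) ^ s.+2.

Lemma multiplicity_le : tau <= K ^ (5 * r ^ 2).
Proof.
have h : 2 * (K ^ 2) ^ (2 * s) <= K ^ (1 + 4 * s).
  rewrite expnD expn1 leq_mul // -expnM; apply: leq_expK; lia.
apply: (@leq_trans (K ^ (1 + (1 + 4 * s) * s.+2))).
  by rewrite expnD expn1 leq_mul // (expnM K (1 + 4 * s)) leq_exp2r.
by apply: leq_expK; rewrite /r; clear; nia.
Qed.

Lemma multiplicity_sq_le : 2 * tau ^ 2 <= K ^ (1 + 10 * r ^ 2).
Proof.
rewrite expnD expn1 leq_mul //.
apply: (@leq_trans ((K ^ (5 * r ^ 2)) ^ 2)); first by rewrite leq_exp2r ?multiplicity_le.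
by rewrite -expnM; apply: leq_expK; lia.
Qed.

Variable lam : nat.
Hypotheses (lam0 : 0 < lam) (r9 : 9 <= r).

Lemma r2lam_bounds : [/\ 9 * r <= r ^ 2, r ^ 2 <= r ^ 2 * lam, r * lam <= r ^ 2 * lam & 9 * (r * lam) <= r ^ 2 * lam].
Proof.
have h : 9 * r <= r ^ 2 by rewrite -mulnn leq_mul2r r9 orbT.
split=> //; first by rewrite leq_pmulr.
  by rewrite leq_mul2r -{1}[r]expn1 leq_pexp2l // orbT.
by rewrite mulnA leq_mul2r h orbT.
Qed.

Variable N : nat.
Hypothesis KN : K ^ (100 * r ^ 2 * lam) <= N.

Let Y := K ^ (20 * r ^ 2 * lam).
(** The number of exponents allowed in each variable of the auxiliary
    polynomials.  The scale [Y] is chosen so that it exceeds all the losses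
    in the choice of [Th] and of the tuples, while [Y ^ r] remains small
    compared with [N ^ r / p]. *)
Definition box_size := N %/ Y.

Lemma scale_gt0 : 0 < Y.
Proof. by rewrite expn_gt0 ltnW. Qed.

Lemma scale_le : Y <= N.
Proof. by apply: leq_trans KN; apply: leq_expK; rewrite !leq_mul2r orbT. Qed.

Lemma N_gt0 : 0 < N. Proof. exact: leq_trans scale_gt0 scale_le. Qed.

Lemma box_size_gt0 : 0 < box_size.
Proof. by rewrite divn_gt0 ?scale_gt0 ?scale_le. Qed.

Lemma box_size_scale_le : box_size * Y <= N. Proof. exact: leq_trunc_div. Qed.

(** For the choice of [box_size], the three numerical hypotheses of
    [exists_collision] are this inequality, [slice_lt_set] and
    [slice_lt_field]. *)
Lemma box_beats_field p : p ^ 4 <= N ^ r -> p * (2 * tau ^ 2) <= box_size ^ r.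
Proof.
move=> pN.
have [h1 h2 h3 h4] := r2lam_bounds.
rewrite leqNgt; apply/negP => lt.
have N2 : N <= 2 * box_size * Y.
  have := ltn_ceil N scale_gt0; rewrite -/box_size => /ltnW/leq_trans; apply.
  by rewrite leq_mul2r mul2n -addnn -addn1 leq_add2l box_size_gt0 orbT.
have h5 : N ^ r <= K ^ (r + r * (20 * r ^ 2 * lam)) * box_size ^ r.
  apply: (@leq_trans ((2 * box_size * Y) ^ r)); first by rewrite leq_exp2r.
  rewrite expnD (mulnC r (_ * lam)) expnM -expnMn -expnMn leq_exp2r //.
  by rewrite -/Y mulnAC leq_mul2r leq_mul ?orbT.
have h6 : N ^ r < K ^ (r + r * (20 * r ^ 2 * lam)) * (p * K ^ (1 + 10 * r ^ 2)).
  apply: leq_ltn_trans h5 _; rewrite ltn_pmul2l ?expn_gt0 ?(ltnW K2) //.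
  by apply: leq_trans lt _; rewrite leq_mul2l multiplicity_sq_le orbT.
have h7 : (N ^ r) ^ 4 < (K ^ (r + r * (20 * r ^ 2 * lam) + (1 + 10 * r ^ 2))) ^ 4 * N ^ r.
  apply: (@leq_trans ((K ^ (r + r * (20 * r ^ 2 * lam) + (1 + 10 * r ^ 2))) ^ 4 * p ^ 4));
    last by rewrite leq_mul2l pN orbT.
  rewrite -expnMn ltn_exp2r // (leq_trans h6) //.
  by rewrite (expnD K (r + _) (1 + _)) mulnA mulnAC.
have Nr : 0 < N ^ r by rewrite expn_gt0 N_gt0.
move: h7; rewrite expnSr ltn_pmul2r // ltnNge => /negP; apply.
(* What remains is an inequality between exponents of [K], as [N ^ (3 r)] is at
   least [K ^ (300 r ^ 3 lam)]. *)
apply: (@leq_trans (((K ^ (100 * r ^ 2 * lam)) ^ r) ^ 3)); last by rewrite leq_exp2r // leq_exp2r.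
rewrite -!expnM; apply: leq_expK.
have h8 : 9 * (r ^ 2 * lam) <= r * (r ^ 2 * lam) by rewrite leq_mul2r r9 orbT.
have -> : 100 * r ^ 2 * lam * (r * 3) = 300 * (r * (r ^ 2 * lam)) by ring.
have -> : r * (20 * r ^ 2 * lam) = 20 * (r * (r ^ 2 * lam)) by ring.
by move: (r * (r ^ 2 * lam)) (r ^ 2 * lam) h1 h2 h8 => u v; clear; lia.
Qed.

Variable d : nat.
Hypotheses (d0 : 0 < d) (dl : d <= 2 ^ lam).
Let e := (r * box_size.-1 * d ^ r).+1.

Lemma leq_dK : d <= K ^ lam.
Proof. exact: leq_trans dl (leq_2K lam). Qed.

Lemma leq_dSK : d.+1 <= K ^ lam.+1.
Proof.
apply: leq_trans (leq_2K _); rewrite expnS mul2n -addnn -addn1 leq_add //.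
by rewrite expn_gt0.
Qed.

Lemma leq_dr : d ^ r <= K ^ (r * lam).
Proof. by rewrite mulnC expnM leq_exp2r ?leq_dK. Qed.

Lemma slice_bound_le : r * e <= box_size * K ^ (2 * r + r * lam).
Proof.
have e1 : e <= r * box_size * d ^ r.
  have dr0 : 0 < r * d ^ r by rewrite muln_gt0 expn_gt0 d0.
  rewrite /e mulnAC [in X in _ <= X]mulnAC -{2}(prednK box_size_gt0).
  by rewrite [in X in _ <= X]mulnS -addn1 addnC leq_add2r.
apply: leq_trans (leq_mul (leqnn r) e1) _.
have -> : r * (r * box_size * d ^ r) = box_size * (r * r * d ^ r) by ring.
rewrite leq_mul2l expnD; apply/orP; right; apply: leq_mul leq_dr.
by rewrite mul2n -addnn expnD leq_mul ?leq_natK.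
Qed.

Lemma slice_lt_set cA : N <= K * cA ->
  r * e * tau * ((K ^ 2) ^ 3) ^ (2 * (r * lam) * s) < cA.
Proof.
move=> NcA; have [h1 h2 h3 h4] := r2lam_bounds.
have K0 : 0 < K by apply: ltnW.
rewrite -(ltn_pmul2l K0); apply: leq_trans NcA.
apply: leq_trans box_size_scale_le.
apply: (@leq_ltn_trans (K * (box_size * K ^ (2 * r + r * lam) * K ^ (5 * r ^ 2) * K ^ (12 * (r ^ 2 * lam))))).
  rewrite leq_mul2l; apply/orP; right; apply: leq_mul.
    exact: leq_mul slice_bound_le multiplicity_le.
  apply: (@leq_trans (K ^ (12 * (r * s * lam)))).
    by apply: eq_leq; rewrite -!expnM; congr (_ ^ _); ring.
  apply: leq_expK; rewrite -mulnn.
  by rewrite leq_mul2l leq_mul2r leq_mul2l leqnSn !orbT.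
have -> : K * (box_size * K ^ (2 * r + r * lam) * K ^ (5 * r ^ 2) * K ^ (12 * (r ^ 2 * lam)))
   = box_size * K ^ (1 + (2 * r + r * lam) + 5 * r ^ 2 + 12 * (r ^ 2 * lam)).
  by rewrite !expnD expn1; ring.
rewrite ltn_pmul2l ?box_size_gt0 // ltn_exp2l //; lia.
Qed.

Lemma slice_lt_field p : N ^ 2 <= p -> r * (e + d ^ r) < p.
Proof.
move=> N2p.
have [h1 h2 h3 h4] := r2lam_bounds.
apply: (@leq_ltn_trans (box_size * K ^ (1 + 2 * r + r * lam))).
  have -> : box_size * K ^ (1 + 2 * r + r * lam) = K * (box_size * K ^ (2 * r + r * lam)).
    by rewrite -addnA expnD expn1 mulnCA.
  apply: (@leq_trans (2 * (box_size * K ^ (2 * r + r * lam)))); last by rewrite leq_mul2r K2 orbT.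
  rewrite mulnDr mul2n -addnn leq_add ?slice_bound_le //.
  apply: (@leq_trans (K ^ (2 * r + r * lam))); last by rewrite leq_pmull ?box_size_gt0.
  rewrite expnD leq_mul ?leq_dr //; apply: leq_trans (leq_natK r) _; apply: leq_expK.
  by rewrite leq_pmull.
apply: (@leq_trans (box_size * Y)).
  rewrite ltn_pmul2l ?box_size_gt0 // ltn_exp2l //; lia.
apply: leq_trans box_size_scale_le (leq_trans _ N2p).
by rewrite -mulnn leq_pmulr ?N_gt0.
Qed.

End Numerics.

(** * Descent on the number of terms *)

Lemma leq_expn2r m n k : (m <= n -> m ^ k <= n ^ k)%N.
Proof. by case: k => // k mn; rewrite leq_exp2r. Qed.

Lemma Fp_nat_neq0 p : prime p -> forall n, (0 < n < #|'F_p|)%N -> n%:R != 0 :> 'F_p.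
Proof.
move=> pp n; rewrite card_Fp // => /andP[n0 np].
rewrite -(dvdn_pcharf (pchar_Fp pp)) gtnNdvd //.
Qed.

Lemma card_polyimage_ge (F : finFieldType) (f : {poly F}) (A : {set F}) :
  (1 < size f)%N -> (#|A| <= size f * #|polyimage f A|)%N.
Proof.
move=> sf; rewrite mulnC; apply: (leq_card_fiber (phi := fun x => f.[x])).
  by move=> x xA; apply: imset_f.
move=> y _; have fy : size (f - y%:P) = size f.
  by rewrite size_polyDl // size_polyN (leq_ltn_trans (size_polyC_leq1 _)).
have fy0 : f - y%:P != 0 by rewrite -size_poly_eq0 fy; case: (size f) sf.
rewrite -fy; apply: leq_trans (card_roots_le fy0).
apply/subset_leq_card/subsetP => x; rewrite !inE => /andP[_ /eqP e].
by rewrite /root hornerD hornerN hornerC e subrr.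
Qed.

Definition coef_supp (F : finFieldType) d (f : {poly F}) : {set 'I_d.+1} := [set i : 'I_d.+1 | f`_i != 0].
Arguments coef_supp {F} d f.

Section Descent.
Variables (p N s d lam : nat).
Let r := s.+1.
Hypotheses (pp : prime p) (d0 : (0 < d)%N) (dl : (d <= 2 ^ lam)%N) (lam0 : (0 < lam)%N).
Hypotheses (r9 : (9 <= r)%N) (N2p : (N ^ 2 <= p)%N) (pN : (p ^ 4 <= N ^ r)%N).
Let M := (100 * r ^ 2 * lam)%N.

(** All sizes are compared with a fixed [N], the size of the initial set, so
    that the losses of successive steps only affect [K]. *)
Definition structured (f : {poly 'F_p}) (A : {set 'F_p}) (K : nat) :=
  [/\ 0 \notin A, (N <= K * #|A|)%N, (#|A| <= N)%N, (#|prodset A A| <= K * N)%N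
    & (#|sumset (polyimage f A) (polyimage f A)| <= K * N)%N].

Definition admissible_poly (f : {poly 'F_p}) := [/\ f`_0 = 0, (size f <= d.+1)%N & (1 < size f)%N].

Lemma structured_gt0 f A K : (2 <= K)%N -> (K ^ M <= N)%N -> structured f A K -> A != set0.
Proof.
move=> K2 KN [_ + _ _ _]; rewrite -card_gt0.
have : (0 < N)%N by apply: leq_trans KN; rewrite expn_gt0 ltnW.
by case: #|A| => //; rewrite muln0; case: (N).
Qed.

(** Up to a factor, [f] is a monomial of exponent [i]; the set [B] of the
    powers of exponent [i] of the elements of [A] has small sum set and
    small product set. *)
Lemma no_structured_monomial f A K (i : nat) : admissible_poly f ->
  (2 <= K)%N -> (K ^ M <= N)%N -> (forall j, f`_j != 0 -> j = i) -> ~ structured f A K.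
Proof.
move=> [f0 sfd sf] K2 KN only st; have A0 := structured_gt0 K2 KN st.
case: st => nA0 NA AN AA fA.
have K0 : (0 < K)%N := ltnW K2.
have lead : f`_(size f).-1 != 0 by rewrite -lead_coefE lead_coef_eq0 -size_poly_gt0 ltnW.
have ei := only _ lead; rewrite {}ei in lead.
have i0 : (0 < i)%N by rewrite lt0n; apply: contraNneq lead => ->; rewrite f0.
have fE : f = f`_i *: 'X^i.
  apply/polyP => j; rewrite coefZ coefXn; case: eqP => [->|/eqP ji]; first by rewrite mulr1.
  by rewrite mulr0; apply/eqP; apply: contraNT ji => /only->.
pose B := polyimage 'X^i A.
have fB : polyimage f A = dilate f`_i B.
  rewrite /polyimage /dilate -imset_comp; apply: eq_imset => x /=.
  by rewrite {1}fE hornerZ.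
have sX : (size ('X^i : {poly 'F_p}) <= d.+1)%N.
  by rewrite size_polyXn -(size_polyXn 'F_p i) -(size_scale _ lead) -fE.
have AB : (#|A| <= d.+1 * #|B|)%N.
  apply: leq_trans (card_polyimage_ge (f := 'X^i) A _) _; first by rewrite size_polyXn.
  by rewrite leq_mul2r sX orbT.
have KNB : (K * N <= K ^ 2 * d.+1 * #|B|)%N.
  apply: leq_trans (leq_mul (leqnn K) (leq_trans NA (leq_mul (leqnn K) AB))) _.
  by rewrite !mulnA.
have BX x : x \in A -> x ^+ i \in B.
  by move=> xA; apply/imsetP; exists x; rewrite ?hornerXn.
have nB0 : 0 \notin B.
  apply/imsetP => -[x xA /esym/eqP]; rewrite hornerXn expf_eq0 i0 /= => /eqP x0.
  by rewrite x0 (negbTE nA0) in xA.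
have B0 : B != set0 by have [x xA] := set0Pn _ A0; apply/set0Pn; exists (x ^+ i); apply: BX.
have Bp : (#|B| ^ 2 <= p)%N.
  apply: leq_trans N2p; rewrite leq_sqr (leq_trans _ AN) //; exact: leq_imset_card.
have BB : (#|prodset B B| <= K ^ 2 * d.+1 * #|B|)%N.
  apply: leq_trans KNB; apply: leq_trans AA.
  apply: leq_trans (leq_imset_card (fun z => z ^+ i) _).
  apply/subset_leq_card/subsetP => _ /imset2P[_ _ /imsetP[x xA ->] /imsetP[y yA ->] ->].
  by apply/imsetP; exists (x * y); rewrite ?mem_prodset // !hornerXn exprMn.
have sB : (#|sumset B B| <= K ^ 2 * d.+1 * #|B|)%N.
  apply: leq_trans KNB; apply: leq_trans fA; rewrite fB -(card_dilate (sumset B B) lead).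
  apply/subset_leq_card/subsetP => _ /imsetP[_ /imset2P[x y xB yB ->] ->].
  by rewrite mulrDr; apply: mem_sumset; apply: imset_f.
have SP := sum_product_Fp pp nB0 B0 Bp BB sB.
have dK := leq_dSK K2 dl.
have N_le : (N <= K ^ (1 + lam.+1 + (9 + (2 + lam.+1) * 26)))%N.
  apply: leq_trans NA _; rewrite -addnA expnD expn1 leq_mul //.
  apply: leq_trans AB _; rewrite expnD; apply: leq_mul => //.
  apply: leq_trans SP _; rewrite expnD; apply: leq_mul.
    exact: (leq_2K K2 9).
  by rewrite expnM leq_exp2r // expnD leq_mul.
have := leq_trans KN N_le; apply/negP; rewrite -ltnNge ltn_exp2l //.
have r81 : (81 <= r ^ 2)%N by rewrite (_ : 81 = 9 ^ 2)%N // leq_sqr.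
have : (81 * lam <= r ^ 2 * lam)%N by rewrite leq_mul2r r81 orbT.
by rewrite /M -mulnA; move: (r ^ 2 * lam)%N lam0 => u; clear; lia.
Qed.

(** With [w i] the difference of the power sums of exponent [i] of the two
    tuples of [exists_collision], the coefficients of [g] are the
    [f`_i * w i]; the losses in size are all at most [K ^ M]. *)
Lemma elimination_step f A K (a b : nat) : admissible_poly f ->
  (2 <= K)%N -> (K ^ M <= N)%N -> f`_a != 0 -> f`_b != 0 -> a != b -> structured f A K ->
  exists g B, [/\ admissible_poly g, coef_supp d g \proper coef_supp d f & structured g B (K ^ M)].
Proof.
move=> [f0 sfd sf] K2 KN fa fb ab st; have A0 := structured_gt0 K2 KN st.
case: st => nA0 NA AN AA fA.
have K0 : (0 < K)%N := ltnW K2.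
have inD n : f`_n != 0 -> (0 < n <= d)%N.
  move=> fn; rewrite lt0n; apply/andP; split; first by apply: contraNneq fn => ->; rewrite f0.
  by rewrite -ltnS (leq_trans _ sfd) // ltnNge; apply: contra fn => /leq_sizeP->.
have /andP[a0 ad] := inD a fa; have /andP[b0 bd] := inD b fb.
have AA2 : (#|prodset A A| <= K ^ 2 * #|A|)%N.
  by apply: leq_trans AA _; rewrite -mulnn -mulnA leq_mul2l NA orbT.
have powd n1 n2 n : (n1 + n2 <= n)%N -> (a ^ n1 * b ^ n2 <= d ^ n)%N.
  move=> le; apply: leq_trans (leq_pexp2l d0 le); rewrite expnD.
  by apply: leq_mul; rewrite leq_expn2r.
have K20 : (0 < K ^ 2)%N by rewrite expn_gt0 K0.
have s0 : (0 < s)%N by move: r9; rewrite /r; case: (s).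
have [|||||X [h [h' [AX Xh Xh' ea eb]]]] := @exists_collision 'F_p (Fp_nat_neq0 pp) A (K ^ 2) a b s (d ^ r) (r * lam)
   (box_size K s lam N) nA0 A0 AA2 a0 b0 ab K20 s0.
- by move=> i le; apply: powd; rewrite /r subnK.
- move=> i lt; apply: (@leq_ltn_trans (d ^ s.-1)); first by apply: powd; rewrite subnK // -ltnS prednK.
  apply: (@leq_ltn_trans (2 ^ (lam * s.-1))); first by rewrite expnM leq_expn2r.
  rewrite ltn_exp2l // mulnC ltn_mul2r lam0 /r; case: (s) s0 => // s' _; exact: leqW.
- by rewrite card_Fp //; apply: slice_lt_field.
- exact: slice_lt_set.
- by apply: leq_trans (leq_mul (eq_leq (card_Fp pp)) (leqnn _)) _; apply: box_beats_field.
pose w i := \sum_j h j ^+ i - \sum_j h' j ^+ i.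
pose g := \poly_(i < d.+1) (f`_i * w i).
have gE i : g`_i = f`_i * w i.
  rewrite coef_poly ltnS; case: leqP => // di.
  by rewrite nth_default ?mul0r // (leq_trans sfd).
have gX u : g.[u] = \sum_j f.[u * h j] - \sum_j f.[u * h' j].
  rewrite horner_poly -sumrB.
  rewrite (eq_bigr (fun j => \sum_(i < d.+1) f`_i * (h j ^+ i - h' j ^+ i) * u ^+ i)) => [|j _].
    rewrite exchange_big /=; apply: eq_bigr => i _.
    by rewrite -mulr_suml -mulr_sumr /w -sumrB.
  rewrite !(horner_coef_wide _ sfd) -sumrB; apply: eq_bigr => i _.
  by rewrite !exprMn; ring.
have wb : w b != 0 by rewrite /w subr_eq0.
have gb : g`_b != 0 by rewrite gE mulf_neq0.
have g0 : g`_0 = 0 by rewrite gE f0 mul0r.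
have nzA y : y \in A -> y != 0 by move=> yA; apply: contraNneq nA0 => <-.
exists g, X; split.
- split => //; first exact: size_poly.
  rewrite ltnNge; apply: contra gb => sg; apply/eqP.
  by rewrite nth_default // (leq_trans sg).
- apply/properP; split.
    by apply/subsetP => i; rewrite !inE gE; apply: contraNneq => ->; rewrite mul0r.
  exists (inord a); first by rewrite inE inordK.
  by rewrite inE inordK // gE /w ea subrr mulr0 eqxx.
have t2 := multiplicity_sq_le K2 s.
have h0 u : u \in X -> u * h ord0 != 0 by move=> uX; apply: nzA; apply: Xh.
have X0 : X != set0.
  rewrite -card_gt0; move: AX; case: #|X| => //; rewrite muln0 leqn0 cards_eq0.
  by rewrite (negbTE A0).
have [u0 u0X] := set0Pn _ X0.
have hn0 : h ord0 != 0 by have := h0 u0 u0X; rewrite mulf_eq0 negb_or => /andP[].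
have [r1 r2 r3 r4] := r2lam_bounds lam0 r9.
have KM n : (n <= M)%N -> (K ^ n <= K ^ M)%N by move=> ?; rewrite leq_pexp2l.
have ME : M = (100 * (r ^ 2 * lam))%N by rewrite /M mulnA.
split.
- by apply/negP => /h0; rewrite mul0r eqxx.
- apply: leq_trans NA (leq_trans (leq_mul (leqnn K) AX) _).
  rewrite mulnA leq_mul2r; apply/orP; right.
  apply: leq_trans (leq_mul (leqnn K) t2) _; rewrite -expnS; apply: KM.
  rewrite ME; move: r9 r1 r2; rewrite -/r; move: (r ^ 2 * lam)%N (r ^ 2)%N => x y; clear; lia.
- apply: leq_trans AN; rewrite -(@card_in_imset _ _ (fun u => u * h ord0)) => [|x y _ _]; last exact: mulIf.
  by apply/subset_leq_card/subsetP => _ /imsetP[u uX ->]; apply: Xh.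
- apply: leq_trans (_ : _ <= #|prodset A A|)%N _.
    rewrite -(card_dilate (prodset X X) (mulf_neq0 hn0 hn0)).
    apply/subset_leq_card/subsetP => _ /imsetP[_ /imset2P[x y xX yX ->] ->].
    have -> : h ord0 * h ord0 * (x * y) = (x * h ord0) * (y * h ord0) by ring.
    by rewrite mem_prodset ?Xh.
  apply: leq_trans AA _; rewrite leq_mul2r -{1}[K]expn1 KM ?orbT //.
  by rewrite ME muln_gt0 /= muln_gt0 lam0 ?expn_gt0.
pose Bf := polyimage f A.
have Bf0 : Bf != set0 by have [x xA] := set0Pn _ A0; apply/set0Pn; exists f.[x]; apply: imset_f.
have memBf x : x \in A -> f.[x] \in Bf by move=> xA; apply: imset_f.
have ABf : (#|A| <= d.+1 * #|Bf|)%N.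
  by apply: leq_trans (card_polyimage_ge A sf) _; rewrite leq_mul2r sfd orbT.
have dK := leq_dSK K2 dl.
have BB : (#|sumset Bf Bf| <= K ^ (lam + 3) * #|Bf|)%N.
  apply: leq_trans fA (leq_trans (leq_mul (leqnn K) (leq_trans NA (leq_mul (leqnn K) ABf))) _).
  rewrite !mulnA leq_mul2r; apply/orP; right.
  have -> : (lam + 3 = 2 + lam.+1)%N by rewrite addnC addSnnS.
  by rewrite expnD mulnn leq_mul2l dK orbT.
apply: leq_trans (card_signed_sums (m := r + r) Bf0 BB _) _.
  move=> _ /imset2P[_ _ /imsetP[x xX ->] /imsetP[y yX ->] ->].
  exists (fun j => match split j with inl i => f.[x * h i] | inr i => f.[y * h i] end).
  exists (fun j => match split j with inl i => f.[x * h' i] | inr i => f.[y * h' i] end).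
  split.
  - by move=> j; case: (split j) => i; apply/memBf/Xh.
  - by move=> j; case: (split j) => i; apply/memBf/Xh'.
  have sp (u v : 'I_r -> 'F_p) : \sum_(j < r + r) match split j with inl i => u i | inr i => v i end
      = \sum_j u j + \sum_j v j.
    rewrite big_split_ord; congr (_ + _); apply: eq_bigr => j _.
      by rewrite (unsplitK (inl j)).
    by rewrite (unsplitK (inr j)).
  by rewrite !sp !gX; ring.
apply: leq_mul; last by apply: leq_trans AN; apply: leq_imset_card.
rewrite -expnM; apply: KM; rewrite ME mulnC mulnDr.
have -> : ((r + r + (r + r)) * lam = 4 * (r * lam))%N by ring.
move: r1 r2 r3; rewrite -/r; move: (r ^ 2 * lam)%N (r ^ 2)%N (r * lam)%N => x y z; clear; lia.
Qed.

(** Each elimination replaces [K] by [K ^ M], and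
    [(K ^ M) ^ (M ^ k) = K ^ (M ^ k.+1)]. *)
Theorem no_structured_set k f A K : (#|coef_supp d f| <= k)%N -> admissible_poly f ->
  (2 <= K)%N -> (K ^ (M ^ k) <= N)%N -> ~ structured f A K.
Proof.
elim: k f A K => [|k IHk] f A K.
  rewrite leqn0 cards_eq0 => /eqP supp [f0 sfd sf] _ _ _.
  have : inord (size f).-1 \in coef_supp d f.
    rewrite inE inordK ?prednK ?(ltnW sf) //.
    by rewrite -lead_coefE lead_coef_eq0 -size_poly_gt0 ltnW.
  by rewrite supp inE.
move=> suppk adm K2 KN st.
have KM : (K ^ M <= N)%N.
  apply: leq_trans KN; rewrite leq_pexp2l ?(ltnW K2) // expnS leq_pmulr // expn_gt0.
  by rewrite /M !muln_gt0 lam0 ?expn_gt0.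
have [f0 sfd sf] := adm.
have lead : f`_(size f).-1 != 0 by rewrite -lead_coefE lead_coef_eq0 -size_poly_gt0 ltnW.
have [/existsP[b /andP[fb ab]]|none] := boolP [exists b : 'I_d.+1, (f`_b != 0) && ((size f).-1 != b)].
  have [g [B [admg sub stg]]] := elimination_step adm K2 KM lead fb ab st.
  apply: (IHk g B (K ^ M)%N _ admg _ _ stg).
  - by rewrite -ltnS (leq_trans (proper_card sub)).
  - rewrite (leq_trans K2) // -{1}[K]expn1 leq_pexp2l ?(ltnW K2) //.
    by rewrite /M !muln_gt0 lam0 ?expn_gt0.
  - by rewrite -expnM -expnS.
apply: (no_structured_monomial (i := (size f).-1) adm K2 KM _ st) => j fj.
have jd : (j < d.+1)%N by rewrite ltnNge; apply: contra fj => sj; rewrite nth_default // (leq_trans sfd).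
apply/eqP; rewrite eq_sym; apply: contraR none => ne.
by apply/existsP; exists (Ordinal jd); rewrite fj.
Qed.

End Descent.

(** * Real exponents *)

(** Raising the lower bound to the power [r] gives
    [p ^ 4 d ^ (40 r ^ 2) <= N ^ r], and together with [N ^ 2 <= p] this
    forces [N ^ 8 < N ^ r]. *)
Lemma size_parameters (R : realType) (p r d N : nat) :
  prime p -> (2 <= d)%N -> (0 < r)%N ->
  p%:R `^ (4 / r%:R) * d%:R ^+ (40 * r) <= N%:R :> R -> N%:R <= Num.sqrt p%:R :> R ->
  [/\ (1 < N)%N, (9 <= r)%N, (N ^ 2 <= p)%N & (p ^ 4 <= N ^ r)%N].
Proof.
move=> pp d2 r0 lb ub; have p1 := prime_gt1 pp.
have r0' : r%:R != 0 :> R by rewrite pnatr_eq0 -lt0n.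
have gt1_exp m n : (1 < m -> 0 < n -> 1 < m ^ n)%N.
  by move=> m1; have := ltn_exp2l 0 n m1; rewrite expn0 => ->.
have d1 : (1 < d ^ (40 * r))%N by rewrite gt1_exp ?muln_gt0.
have N1 : (1 < N)%N.
  rewrite -(ltr_nat R); apply: lt_le_trans lb.
  rewrite -natrX -[X in X < _]mul1r; apply: (@lt_le_trans _ _ (1 * (d ^ (40 * r))%:R)).
    by rewrite !mul1r (ltr_nat R 1).
  rewrite ler_wpM2r // -[X in X <= _](powRr0 p%:R) ler_powR //.
    by rewrite (ler_nat R 1) ltnW.
  by rewrite divr_ge0.
have Np : (N ^ 2 <= p)%N.
  rewrite -(ler_nat R) natrX -[X in _ <= X](@sqr_sqrtr R p%:R) //.
  by rewrite ler_sqr ?nnegrE ?sqrtr_ge0.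
have pN : (p ^ 4 * (d ^ (40 * r)) ^ r <= N ^ r)%N.
  rewrite -(ler_nat R) natrM !natrX.
  have -> : p%:R ^+ 4 = (p%:R `^ (4 / r%:R)) ^+ r :> R.
    by rewrite -[RHS]powR_mulrn ?powR_ge0 // -powRrM divfK // powR_mulrn.
  rewrite -exprMn; apply: lerXn2r => //; rewrite ?nnegrE //.
  by rewrite mulr_ge0 ?powR_ge0 // exprn_ge0.
have pN' : (p ^ 4 < N ^ r)%N.
  apply: leq_trans pN; rewrite -[X in (X < _)%N]muln1 ltn_pmul2l ?expn_gt0 ?(ltnW p1) //.
  exact: gt1_exp.
split=> //; last exact: ltnW.
rewrite -(ltn_exp2l _ _ N1); apply: leq_ltn_trans pN'.
by rewrite (expnM N 2 4) leq_exp2r.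
Qed.

Lemma up_log2_le (R : realType) d : (2 <= d)%N -> (up_log 2 d)%:R <= 2 * log2 d%:R :> R.
Proof.
move=> d2; have ln2 : 0 < ln 2 :> R by apply: ln_gt0; rewrite (ltr_nat R 1).
have lnd n : (n <= d)%N -> (0 < n)%N -> ln n%:R <= ln d%:R :> R.
  by move=> nd n0; rewrite ler_ln ?ler_nat // posrE ltr0n // (leq_trans n0).
have := up_log_gtn (isT : (1 < 2)%N) d2; set l := up_log 2 d => lt.
have l0 : (0 < l)%N by rewrite up_log_gt0.
have h1 : l.-1%:R <= log2 d%:R :> R.
  rewrite /log2 ler_pdivlMr // mulr_natl -lnXn ?ltr0n // -natrX lnd ?expn_gt0 //.
  exact: ltnW.
have h2 : 1 <= log2 d%:R :> R by rewrite /log2 ler_pdivlMr // mul1r lnd.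
by rewrite -(prednK l0) -addn1 natrD mulr2n mulrDl !mul1r lerD.
Qed.

(** [K] is the integer part of [N `^ epsilon] plus [1], so that
    [K <= N `^ (2 epsilon)].  As [up_log 2 d <= 2 log2 d], the
    factor [100 r ^ 2 up_log 2 d] is at most half of the base
    of the power [epsilon], and the [k]-th power of [1 / 2] compensates for
    the factor [2]. *)
Lemma exists_growth_constant (R : realType) (N k r d : nat) :
  (2 <= d)%N -> (0 < k)%N -> (1 < N)%N -> 2 <= N%:R `^ epsilon R k r d ->
  exists K : nat, [/\ (2 <= K)%N, N%:R `^ epsilon R k r d <= K%:R
    & (K ^ ((100 * r ^ 2 * up_log 2 d) ^ k) <= N)%N].
Proof.
move=> d2 k0 N1; set ep := epsilon R k r d => Ne.
have N1' : 1 <= N%:R :> R by rewrite (ler_nat R 1) ltnW.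
have ge0 : 0 <= N%:R `^ ep by rewrite powR_ge0.
have := truncn_itv ge0; set K := (Num.truncn _).+1 => /andP[h1 h2].
exists K; split.
- by rewrite -(ler_nat R) (le_trans Ne) // ltW.
- exact: ltW.
have KN : K%:R <= N%:R `^ (2 * ep).
  rewrite mulr_natl mulr2n powRD; last by apply/implyP => _; rewrite gt_eqF // (lt_le_trans ltr01).
  apply: (@le_trans _ _ (2 * N%:R `^ ep)); last by rewrite ler_wpM2r.
  rewrite /K -addn1 natrD mulr2n mulrDl mul1r lerD //.
  by apply: le_trans Ne; rewrite (ler_nat R 1).
have l2 := @up_log2_le R d d2.
set l := up_log 2 d in l2 *.
have l0 : (0 < l)%N by rewrite up_log_gt0.
set M := (100 * r ^ 2 * l)%N.
(* [epsilon] is the inverse of [L ^+ k]. *)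
pose L : R := 5000 * (r + k)%:R ^+ 2 * log2 d%:R.
have lg0 : 0 < log2 d%:R :> R.
  by rewrite -(@pmulr_rgt0 _ 2) // (lt_le_trans _ l2) // ltr0n.
have rk0 : 0 < (r + k)%:R :> R by rewrite ltr0n addn_gt0 k0 orbT.
have L0 : 0 < L by apply: mulr_gt0 lg0; apply: mulr_gt0; [rewrite ltr0n | rewrite exprn_gt0].
have ML : M%:R * 2 <= L.
  rewrite /M /L (natrM _ (_ * _)) (natrM _ 100) natrX.
  have h3 : r%:R ^+ 2 <= (r + k)%:R ^+ 2 :> R.
    by rewrite ler_sqr ?nnegrE // ler_nat leq_addr.
  have h4 : r%:R ^+ 2 * l%:R <= (r + k)%:R ^+ 2 * (2 * log2 d%:R) :> R.
    by apply: ler_pM => //; rewrite exprn_ge0.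
  have h5 : 0 <= (r + k)%:R ^+ 2 * log2 d%:R :> R by rewrite mulr_ge0 ?exprn_ge0 ?ltW.
  nra.
have Me : 2 * ep * (M ^ k)%:R <= 1.
  have h6 : (M ^ k)%:R * 2 ^+ k <= L ^+ k.
    rewrite natrX -exprMn; apply: lerXn2r => //; rewrite nnegrE; last exact: ltW.
    exact: mulr_ge0.
  have Lk : 0 < L ^+ k by rewrite exprn_gt0.
  rewrite /ep /epsilon -/L mulrAC ler_pdivrMr // mul1r.
  apply: le_trans h6; rewrite mulrC ler_wpM2l //.
  by rewrite -[X in X <= _]expr1 ler_weXn2l // (ler_nat R 1).
rewrite -(ler_nat R) natrX.
apply: (@le_trans _ _ ((N%:R `^ (2 * ep)) ^+ (M ^ k))).
  by rewrite lerXn2r ?nnegrE ?powR_ge0.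
rewrite -powR_mulrn ?powR_ge0 // -powRrM -[X in _ <= X](powRr1 (ler0n _ _)).
exact: ler_powR.
Qed.

Lemma has_terms_supp (F : finFieldType) k (f : {poly F}) (a : 'I_k -> F) (e : 'I_k -> nat) d :
  has_terms f a e -> (forall i, e i <= d)%N -> (size f <= d.+1)%N /\ (#|coef_supp d f| <= k)%N.
Proof.
move=> [_ _ fE] ed; split.
  rewrite fE; apply: leq_trans (size_sum _ _ _) _; apply/bigmax_leqP => i _.
  by rewrite (leq_trans (size_scale_leq _ _)) // size_polyXn ltnS.
rewrite -[k in X in (_ <= X)%N]card_ord; apply: leq_trans (leq_imset_card (fun i => inord (e i)) _).
apply/subset_leq_card/subsetP => n; rewrite inE fE coef_sum => h.
have [/existsP[i /eqP ei]|no] := boolP [exists i, e i == n :> nat].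
  by apply/imsetP; exists i => //; rewrite ei inord_val.
case/eqP: h; rewrite big1 // => i _; rewrite coefZ coefXn.
by move: no; rewrite negb_exists => /forallP/(_ i); rewrite eq_sym => /negbTE->; rewrite mulr0.
Qed.

Theorem theorem3 (R : realType) :
  exists2 C : R, 0 < C &
  forall (p : nat) (hp : prime p)
    (k : nat) (f : {poly 'F_p}) (a : 'I_k -> 'F_p) (e : 'I_k -> nat)
    (hf : has_terms f a e) (f_nonconst : (1 < size f)%N)
    (d : nat) (hd : (2 <= d)%N) (he : forall i, (e i <= d)%N)
    (r : nat) (hr : (0 < r)%N)
    (A : {set 'F_p})
    (hA_lb : p%:R `^ (4 / r%:R) * d%:R ^+ (40 * r) <= #|A|%:R :> R)
    (hA_ub : #|A|%:R <= Num.sqrt p%:R :> R),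
    #|A|%:R `^ (1 + epsilon R k r d)
      <= C * (#|prodset A A|
              + #|sumset (polyimage f A) (polyimage f A)|)%:R.
Proof.
exists 2 => // p hp k f a e hf f1 d hd he r hr A lb ub.
have [N1 r9 Np pN] := size_parameters hp hd hr lb ub.
set N := #|A| in N1 r9 Np pN lb ub *.
set P := #|prodset A A|; set S := #|sumset _ _|.
have [sfd suppk] := has_terms_supp hf he.
have k0 : (0 < k)%N.
  rewrite lt0n; apply: contraTneq f1 => k0; case: hf => _ _ ->.
  by rewrite big1 ?size_poly0 // => i _; have := ltn_ord i; rewrite {2}k0.
have N0 : N%:R != 0 :> R by rewrite pnatr_eq0; case: (N) N1.
have NP : (N <= P)%N.
  have [x xA x0] : exists2 x, x \in A & x != 0.
    have : A :\ 0 != set0.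
      rewrite -card_gt0 lt0n; apply: contraTneq N1 => A0.
      have := cardsD1 0 A; rewrite A0 addn0 -/N => ->; by case: (0 \in A).
    by case/set0Pn => x; rewrite !inE => /andP[? ?]; exists x.
  rewrite /N -(card_dilate A x0); apply/subset_leq_card/subsetP => _ /imsetP[y yA ->].
  exact: mem_prodset.
rewrite powRD; last by rewrite N0 implybT.
rewrite powRr1 //.
have [small|large] := ltP (N%:R `^ epsilon R k r d) 2.
  rewrite mulrC; apply: (@le_trans _ _ (2 * N%:R)); first by rewrite ler_wpM2r // ltW.
  by rewrite ler_wpM2l // ler_nat (leq_trans NP) // leq_addr.
have [K [K2 KN KM]] := exists_growth_constant hd k0 N1 large.
rewrite leNgt; apply/negP => lt.
have PS : (P + S <= K * N)%N.
  rewrite -(ler_nat R) natrM; apply: (@le_trans _ _ (2 * (P + S)%:R)).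
    by rewrite ler_peMl // (ler_nat R 1).
  by rewrite (le_trans (ltW lt)) // mulrC ler_wpM2r.
(* A constant term only translates [f(A) + f(A)], and may be dropped. *)
pose f' := f - (f`_0)%:P; pose A' := A :\ 0.
have sf' : size f' = size f.
  by rewrite size_polyDl // size_polyN (leq_ltn_trans (size_polyC_leq1 _)).
have lam0 : (0 < up_log 2 d)%N by rewrite up_log_gt0.
have dl := up_logP d (isT : (1 < 2)%N).
have rE : r.-1.+1 = r by rewrite prednK.
have [] := @no_structured_set p N r.-1 d (up_log 2 d) hp (ltnW hd) dl lam0 _ Np _ k f' A' K.
- by rewrite rE.
- by rewrite rE.
- apply: leq_trans suppk; apply/subset_leq_card/subsetP => i; rewrite !inE.
  rewrite coefB coefC; have [->|_] := eqVneq (i : nat) 0%N; first by rewrite subrr eqxx.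
  by rewrite subr0.
- split; rewrite ?sf' //.
  by rewrite coefB coefC eqxx subrr.
- by [].
- by rewrite rE.
have cA' : (N <= #|A'|.+1)%N by rewrite /N (cardsD1 0 A); case: (_ \in _); rewrite ?add0n.
split.
- by rewrite !inE eqxx.
- by apply: leq_trans (leq_mul K2 (leqnn _)); lia.
- by apply/subset_leq_card/subsetDl.
- apply: leq_trans PS; apply: leq_trans (leq_addr _ _); apply/subset_leq_card.
  by apply: imset2S; apply: subsetDl.
- apply: leq_trans PS; apply: leq_trans (leq_addl _ _).
  rewrite -(@card_in_imset _ _ (fun z => z + f`_0 + f`_0)) => [|x y _ _]; last by move=> /addIr/addIr.
  apply/subset_leq_card/subsetP => _ /imsetP[_ /imset2P[_ _ /imsetP[x xA ->] /imsetP[y yA ->] ->] ->].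
  have -> : f'.[x] + f'.[y] + f`_0 + f`_0 = f.[x] + f.[y].
    by rewrite /f' !hornerD !hornerN !hornerC; ring.
  by apply: mem_sumset; apply: imset_f; [move: xA | move: yA]; rewrite inE => /andP[].
Qed.
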